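(* Let $k\ge 1$ be an integer. The bijections $\mathbb{B}_t:\mathcal{D}_{\mathrm{alg}}(k)\to\mathcal{D}_{\mathrm{alg}}(k)$, $t\ge 0$, defined by $\mathbb{B}_t(\mu)=\bigl(\mu^{\boxplus(1+t)}\bigr)^{\uplus(1/(1+t))}$ for $\mu\in\mathcal{D}_{\mathrm{alg}}(k)$, have the following properties: (1) $\mathbb{B}_s\circ\mathbb{B}_t=\mathbb{B}_{s+t}$ for every $s,t\ge 0$. (2) $\mathbb{B}_1=\mathbb{B}$, where $\mathbb{B}:\mathcal{D}_{\mathrm{alg}}(k)\to\mathcal{D}_{\mathrm{alg}}(k)$ is the multi-variable Boolean Bercovici-Pata bijection, i.e. the map determined by $R_{\mathbb{B}(\mu)}=\eta_\mu$ for all $\mu\in\mathcal{D}_{\mathrm{alg}}(k)$. (3) For every $t\ge 0$, $\mathbb{B}_t$ is a homomorphism for the free multiplicative convolution: $\mathbb{B}_t(\mu\boxtimes\nu)=\mathbb{B}_t(\mu)\boxtimes\mathbb{B}_t(\nu)$ for all $\mu,\nu\in\mathcal{D}_{\mathrm{alg}}(k)$.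
   Context: Let $\mathbb{C}\langle X_1,\ldots,X_k\rangle$ be the algebra of non-commutative polynomials, and let $\mathcal{D}_{\mathrm{alg}}(k)$ be the set of linear functionals $\mu:\mathbb{C}\langle X_1,\ldots,X_k\rangle\to\mathbb{C}$ with $\mu(1)=1$. For elements $x_1,\ldots,x_k$ of a non-commutative probability space $(\mathcal{A},\varphi)$ (unital complex algebra with a linear functional, $\varphi(1)=1$), their joint distribution is the $\mu\in\mathcal{D}_{\mathrm{alg}}(k)$ with $\mu(X_{i_1}\cdots X_{i_n})=\varphi(x_{i_1}\cdots x_{i_n})$. Let $\mathbb{C}_0\langle\langle z_1,\ldots,z_k\rangle\rangle$ be the space of formal power series with zero constant term in non-commuting indeterminates $z_1,\ldots,z_k$. For $\mu\in\mathcal{D}_{\mathrm{alg}}(k)$: - the moment series is $M_\mu=\sum_{n\ge1}\sum_{i_1,\ldots,i_n=1}^k\mu(X_{i_1}\cdots X_{i_n})z_{i_1}\cdots z_{i_n}$; - the $\eta$-series is $\eta_\mu=M_\mu(1+M_\mu)^{-1}$; - the $R$-transform $R_\mu\in\mathbb{C}_0\langle\langle z_1,\ldots,z_k\rangle\rangle$ is the unique series with $R_\mu\bigl(z_1(1+M_\mu),\ldots,z_k(1+M_\mu)\bigr)=M_\mu$. Both $\mu\mapsto\eta_\mu$ and $\mu\mapsto R_\mu$ are bijections from $\mathcal{D}_{\mathrm{alg}}(k)$ onto $\mathbb{C}_0\langle\langle z_1,\ldots,z_k\rangle\rangle$. For $t>0$, $\mu^{\boxplus t}$ is the unique element of $\mathcal{D}_{\mathrm{alg}}(k)$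 with $R_{\mu^{\boxplus t}}=tR_\mu$, and $\mu^{\uplus t}$ is the unique element with $\eta_{\mu^{\uplus t}}=t\eta_\mu$. The free multiplicative convolution $\mu\boxtimes\nu$ is the joint distribution of $x_1y_1,\ldots,x_ky_k$, where $x_1,\ldots,x_k$ have joint distribution $\mu$, $y_1,\ldots,y_k$ have joint distribution $\nu$, and $\{x_1,\ldots,x_k\}$ is freely independent from $\{y_1,\ldots,y_k\}$ in some non-commutative probability space; it depends only on $\mu,\nu$. *)

(* Defs.v *)
From HB Require Import structures.
From mathcomp Require Import all_boot all_order all_algebra.
From mathcomp Require Import mathcomp_extra boolp classical_sets reals.
From mathcomp Require Export complex.
From mathcomp Require Import monalg.

Set Implicit Arguments.
Unset Strict Implicit.
Unset Printing Implicit Defensive.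

Import GRing.Theory.
Local Open Scope ring_scope.
Local Open Scope classical_set_scope.

(* C<X_1, ..., X_k>, as the algebra of the free monoid over 'I_k. *)
Notation ncpoly C k := {malg C[{fmonom 'I_k}]}.

Definition ncvar (C : fieldType) (k : nat) (i : 'I_k) : ncpoly C k :=
  << fmu i >>.

(* X_{i_1} ... X_{i_n} for w = [:: i_1; ...; i_n]. *)
Definition ncmon (C : fieldType) (k : nat) (w : seq 'I_k) : ncpoly C k :=
  \prod_(i <- w) ncvar C i.

Record dist (C : fieldType) (k : nat) := Dist {
  dist_fun :> {scalar ncpoly C k};
  dist1 : dist_fun 1 = 1
}.

HB.instance Definition _ C k := gen_eqMixin (dist C k).
HB.instance Definition _ C k := gen_choiceMixin (dist C k).

Section DefaultDist.
Variables (C : fieldType) (k : nat).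

Definition coef1 : ncpoly C k -> C := mcoeff (@mone {fmonom 'I_k}).

Fact coef1_is_scalar : scalar coef1.
Proof. by move=> a p q; rewrite /coef1 mcoeffD mcoeffZ. Qed.

HB.instance Definition _ :=
  GRing.isLinear.Build C (ncpoly C k) C *%R coef1 coef1_is_scalar.

Fact coef1_1 : coef1 1 = 1.
Proof. by rewrite /coef1 mcoeff1 eqxx. Qed.

(* The constant-term functional (joint distribution of 0, ..., 0). It only
   serves as the default value of [xget] in the definitions below: the objects
   picked there exist and are unique (convolution powers: for t > 0), so the
   default is never reached. *)
Definition dist0 : dist C k := @Dist C k coef1 coef1_1.
End DefaultDist.

(* Formal power series in k non-commuting indeterminates, given by their
   coefficients: f [:: i_1; ...; i_n] is the coefficient of
   z_{i_1} ... z_{i_n}. *)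
Record ncseries (C : fieldType) (k : nat) := NCSeries {
  nccoef :> seq 'I_k -> C
}.

HB.instance Definition _ C k := gen_eqMixin (ncseries C k).
HB.instance Definition _ C k := gen_choiceMixin (ncseries C k).

Section SeriesAlgebra.
Variables (C : fieldType) (k : nat).
Local Notation series := (ncseries C k).
Implicit Types (f g h : series) (w : seq 'I_k) (a b : C).

Lemma ncseriesP f g : (forall w, f w = g w) -> f = g.
Proof. by case: f g => [f] [g] /= /funext ->. Qed.

Definition ncs0 : series := NCSeries (fun=> 0).
Definition ncsopp f : series := NCSeries (fun w => - f w).
Definition ncsadd f g : series := NCSeries (fun w => f w + g w).
Definition ncs1 : series := NCSeries (fun w => (w == [::])%:R).
Definition ncsmul f g : series := NCSeries (fun w =>
  \sum_(i < (size w).+1) f (take i w) * g (drop i w)).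
Definition ncsscale a f : series := NCSeries (fun w => a * f w).

Fact ncsaddA : associative ncsadd.
Proof. by move=> f g h; apply: ncseriesP => w /=; rewrite addrA. Qed.
Fact ncsaddC : commutative ncsadd.
Proof. by move=> f g; apply: ncseriesP => w /=; rewrite addrC. Qed.
Fact ncsadd0 : left_id ncs0 ncsadd.
Proof. by move=> f; apply: ncseriesP => w /=; rewrite add0r. Qed.
Fact ncsaddN : left_inverse ncs0 ncsopp ncsadd.
Proof. by move=> f; apply: ncseriesP => w /=; rewrite addNr. Qed.

HB.instance Definition _ :=
  GRing.isZmodule.Build series ncsaddA ncsaddC ncsadd0 ncsaddN.

Fact ncsmulA : associative ncsmul.
Proof.
move=> f g h; apply: ncseriesP => w /=; pose n := (size w).+1.
pose F i j := f (take i w) * (g (take (j - i) (drop i w)) * h (drop j w)).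
transitivity (\sum_(i < n) \sum_(j < n | (i <= j)%N) F i j).
  apply: eq_bigr => i _; have lei : (i <= size w)%N by rewrite -ltnS.
  rewrite big_distrr /= size_drop -(big_mkord xpredT (fun j =>
    f (take i w) * (g (take j (drop i w)) * h (drop j (drop i w))))).
  rewrite -subSn // /n -(big_mkord (fun j => i <= j)%N (F i)).
  rewrite [RHS](@big_cat_nat _ _ _ i) //=; last exact: leqW.
  have -> : \sum_(0 <= j < i | (i <= j)%N) F i j = 0.
    by rewrite big_nat_cond big_pred0 // => j; case: ltnP; rewrite ?andbF.
  rewrite add0r; have -> : \sum_(i <= j < (size w).+1 | (i <= j)%N) F i j =
      \sum_(i <= j < (size w).+1) F i j.
    by apply: congr_big_nat => // j /andP[->].
  rewrite -[X in _ = \sum_(X <= _ < _) _]add0n big_addn; apply: eq_bigr => j _.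
  by rewrite /F addnK drop_drop.
rewrite (exchange_big_dep xpredT) //=; apply: eq_bigr => j _.
have lej : (j <= size w)%N by rewrite -ltnS.
rewrite size_take_min (minn_idPl lej) big_distrl /=.
rewrite (big_ord_widen_cond n xpredT (fun i =>
  f (take i (take j w)) * g (drop i (take j w)) * h (drop j w))) //.
apply: eq_big => [i|i leij] /=; first by rewrite ltnS.
by rewrite /F mulrA take_drop subnK // take_takel.
Qed.

Fact ncsmul1 : left_id ncs1 ncsmul.
Proof.
move=> f; apply: ncseriesP => w /=.
rewrite big_ord_recl take0 drop0 mul1r big1 ?addr0 // => i _.
by case: w i => [[]|x w i] //=; rewrite mul0r.
Qed.
Fact ncsmulr1 : right_id ncs1 ncsmul.
Proof.
move=> f; apply: ncseriesP => w /=.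
rewrite big_ord_recr /= take_size drop_size mulr1 big1 ?add0r // => i _.
rewrite -size_eq0 size_drop subn_eq0 leqNgt.
by rewrite (ltn_ord i) mulr0.
Qed.
Fact ncsmulDl : left_distributive ncsmul ncsadd.
Proof.
move=> f g h; apply: ncseriesP => w /=; rewrite -big_split /=.
by apply: eq_bigr => i _; rewrite mulrDl.
Qed.
Fact ncsmulDr : right_distributive ncsmul ncsadd.
Proof.
move=> f g h; apply: ncseriesP => w /=; rewrite -big_split /=.
by apply: eq_bigr => i _; rewrite mulrDr.
Qed.
Fact ncs1_neq0 : ncs1 != 0.
Proof.
apply/eqP => /(congr1 (fun f : series => f [::])) /=.
by apply/eqP; rewrite oner_eq0.
Qed.

HB.instance Definition _ := GRing.Zmodule_isNzRing.Build series
  ncsmulA ncsmul1 ncsmulr1 ncsmulDl ncsmulDr ncs1_neq0.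

Fact ncsscaleA a b f : ncsscale a (ncsscale b f) = ncsscale (a * b) f.
Proof. by apply: ncseriesP => w /=; rewrite mulrA. Qed.
Fact ncsscale1 : left_id 1 ncsscale.
Proof. by move=> f; apply: ncseriesP => w /=; rewrite mul1r. Qed.
Fact ncsscaleDr : right_distributive ncsscale +%R.
Proof. by move=> a f g; apply: ncseriesP => w /=; rewrite mulrDr. Qed.
Fact ncsscaleDl f : {morph ncsscale^~ f : a b / a + b}.
Proof. by move=> a b; apply: ncseriesP => w /=; rewrite mulrDl. Qed.

HB.instance Definition _ := GRing.Zmodule_isLmodule.Build C series
  ncsscaleA ncsscale1 ncsscaleDr ncsscaleDl.

Definition ncsinvertible f := exists g, g * f = 1 /\ f * g = 1.
Definition ncsunit : pred series := fun f => `[< ncsinvertible f >].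
Definition ncsinv f : series := xget f [set g | g * f = 1 /\ f * g = 1].

Fact ncsmulV : {in ncsunit, left_inverse 1 ncsinv *%R}.
Proof. by move=> f /asboolP ex; have [] := xgetPex f ex. Qed.
Fact ncsmulrV : {in ncsunit, right_inverse 1 ncsinv *%R}.
Proof. by move=> f /asboolP ex; have [] := xgetPex f ex. Qed.
Fact ncsunitP f g : g * f = 1 /\ f * g = 1 -> ncsunit f.
Proof. by move=> fg; apply/asboolP; exists g. Qed.
Fact ncsinv_out : {in [predC ncsunit], ncsinv =1 id}.
Proof.
move=> f /negP Nf; rewrite /ncsinv; case: xgetP => // g _ fg.
by case: Nf; apply/asboolP; exists g.
Qed.

HB.instance Definition _ := GRing.NzRing_hasMulInverse.Build series
  ncsmulV ncsmulrV ncsunitP ncsinv_out.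
End SeriesAlgebra.

Section Transforms.
Variables (C : fieldType) (k : nat).
Local Notation series := (ncseries C k).
Implicit Types (mu nu : dist C k) (f g : series).

Definition ncz (i : 'I_k) : series := NCSeries (fun w => (w == [:: i])%:R).

Definition ncseries0 : set series := [set f | f [::] = 0].

Definition moment_series mu : series :=
  NCSeries (fun w => if w is [::] then 0 else mu (ncmon C w)).

Definition eta_series mu : series :=
  moment_series mu * (1 + moment_series mu)^-1.

(* The composition f(g_1, ..., g_k) for g_1, ..., g_k in C_0<<z>>. Since a
   product of n such series has no term of degree < n, only the words of
   length <= size v of f contribute to the coefficient of the word v. *)
Definition ncsubst f (g : 'I_k -> series) : series := NCSeries (fun v =>
  \sum_(n < (size v).+1) \sum_(w : n.-tuple 'I_k)
    f w * (\prod_(i <- w) g i : series) v).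

Definition R_transform mu : series :=
  xget 0 [set f | ncseries0 f /\
    ncsubst f (fun i => ncz i * (1 + moment_series mu)) = moment_series mu].

Definition boolBP mu : dist C k :=
  xget (dist0 C k) [set nu | R_transform nu = eta_series mu].

End Transforms.

Section Freeness.
Variable C : fieldType.

Record ncps := NCPS {
  ncps_alg :> algType C;
  ncps_exp : {scalar ncps_alg};
  ncps_exp1 : ncps_exp 1 = 1
}.

Definition joint_dist (k : nat) (A : ncps) (x : 'I_k -> A) (mu : dist C k) :=
  forall w : seq 'I_k, mu (ncmon C w) = ncps_exp A (\prod_(i <- w) x i).

Definition gen_subalg (A : algType C) (S : set A) : set A :=
  smallest (fun B : set A => GRing.subalg_closed [in B]) S.

(* Free independence of a family of subsets: a word of centered elements
   b_1 ... b_n, n >= 1, with b_j in the subalgebra of index i_j and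
   i_1 != i_2, ..., i_(n-1) != i_n, has expectation 0. *)
Definition freely_independent (A : ncps) (I : eqType) (S : I -> set A) :=
  forall s : seq (I * A), s != [::] ->
    sorted (fun p q => p.1 != q.1) s ->
    {in s, forall p, gen_subalg (S p.1) p.2 /\ ncps_exp A p.2 = 0} ->
    ncps_exp A (\prod_(p <- s) p.2) = 0.

Definition is_free_mul_conv (k : nat) (mu nu rho : dist C k) :=
  exists (A : ncps) (x y : 'I_k -> A),
    [/\ joint_dist x mu, joint_dist y nu,
        freely_independent (fun b : bool => if b then range x else range y)
      & joint_dist (fun i => x i * y i) rho].

Definition free_mul_conv (k : nat) (mu nu : dist C k) : dist C k :=
  xget (dist0 C k) [set rho | is_free_mul_conv mu nu rho].

End Freeness.

Section ConvolutionPowers.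
Local Open Scope complex_scope.
Variables (R : realType) (k : nat).
Implicit Types (t : R) (mu nu : dist R[i] k).

(* Meaningful for t > 0. *)
Definition free_add_pow t mu : dist R[i] k :=
  xget (dist0 R[i] k) [set nu | R_transform nu = t%:C *: R_transform mu].
Definition bool_add_pow t mu : dist R[i] k :=
  xget (dist0 R[i] k) [set nu | eta_series nu = t%:C *: eta_series mu].

Definition Bt t mu : dist R[i] k :=
  bool_add_pow (1 / (1 + t)) (free_add_pow (1 + t) mu).

End ConvolutionPowers.

(* Main.v *)
(* Write eta, eta' for the eta-series of mu and B_t(mu). Eliminating the moment
   series shows that these are related by the single functional equation
     eta(z_j (1 - t eta')^-1) = eta' (1 - t eta')^-1,
   which for t = 1 says that R_{B_1(mu)} = eta_mu. The relation makes sense for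
   every scalar t, composes additively in t under substitution, and is the
   identity for t = 0, so it is a one-parameter group of bijections; this gives
   bijectivity, (1) and (2).

   For (3), the eta-series of mu [x] nu is the boxed convolution of those of mu
   and nu: h = sum_j B_j z_j A_j, where the series A_j, B_j are determined by
     A_j = (d_j g)(B_1 z_1, ..., B_k z_k),  B_j = (f d_j)(z_1 A_1, ..., z_k A_k)
   with d_j stripping a first (resp. last) letter z_j. This is read off a
   factorization of the resolvent of sum_j x_j z_j y_j into alternating products
   of centered elements. Substituting z_j (1 - t h')^-1 in this system, and
   conjugating A_j by 1 + t h, turns it into the same system for the
   transformed series. *)
Require Import Defs.
From HB Require Import structures.
From mathcomp Require Import all_boot all_order all_algebra.
From mathcomp Require Import boolp classical_sets reals complex.
From mathcomp Require Import finmap monalg ring.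

Set Implicit Arguments.
Unset Strict Implicit.
Unset Printing Implicit Defensive.

Import Order.TTheory GRing.Theory Num.Theory.
Local Open Scope ring_scope.

(** * Calculus of non-commutative power series *)

Section WordRecursion.
Variable I : Type.

(** When the right side at [v] reads only shorter words, iterating [F] works: at [v] the iterates
    are constant from step [size v] + 1 on. Inverses, the flow and boxed convolution are all built
    this way. *)
Lemma word_fixpoint (T : Type) (t0 : T) (F : (seq I -> T) -> seq I -> T) :
    (forall e e' v, (forall w, (size w < size v)%N -> e w = e' w) ->
       F e v = F e' v) ->
  exists e, forall v, e v = F e v.
Proof.
move=> Floc; pose it n := iter n F (fun=> t0).
have itS n m v : (size v < n)%N -> (size v < m)%N -> it n v = it m v.
  elim: n m v => // n IHn [//|m] v ltn ltm; apply: Floc => w ltw.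
  by apply: IHn; apply: leq_trans ltw _.
exists (fun v => it (size v).+1 v) => v.
by apply: Floc => w ltw; apply: itS.
Qed.

Lemma word_ind (P : seq I -> Prop) :
    (forall v, (forall w, (size w < size v)%N -> P w) -> P v) ->
  forall v, P v.
Proof.
move=> IH v; have [n] := ubnP (size v); elim: n v => // n IHn v ltv.
by apply: IH => w ltw; apply: IHn; apply: leq_trans ltw _.
Qed.

End WordRecursion.

(** * Series ring: stripping letters, inverting, substituting *)

Section Series.
Variables (C : fieldType) (k : nat).
Local Notation series := (ncseries C k).
Implicit Types (f g h : series) (G K : 'I_k -> series).
Implicit Types (v w : seq 'I_k) (i j : 'I_k) (c t : C).

Definition dl j f : series := NCSeries (fun w => f (j :: w)).
Definition dr j f : series := NCSeries (fun w => f (rcons w j)).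

Lemma ncsD f g w : (f + g) w = f w + g w. Proof. by []. Qed.
Lemma ncsN f w : (- f) w = - f w. Proof. by []. Qed.
Lemma ncsB f g w : (f - g) w = f w - g w. Proof. by []. Qed.
Lemma ncs1E w : (1 : series) w = (w == [::])%:R. Proof. by []. Qed.
Lemma ncsZ c f w : (c *: f) w = c * f w. Proof. by []. Qed.

Lemma ncs_sum (J : Type) (r : seq J) (P : pred J) (F : J -> series) w :
  (\sum_(j <- r | P j) F j) w = \sum_(j <- r | P j) F j w.
Proof. by elim/big_rec2: _ => // j x y _ <-. Qed.

Lemma ncsM_nil f g : (f * g) [::] = f [::] * g [::].
Proof. by rewrite [LHS]/= big_ord1. Qed.

Lemma ncsM_cons f g j w :
  (f * g) (j :: w) = f [::] * g (j :: w) + (dl j f * g) w.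
Proof. by rewrite [LHS]/= big_ord_recl take0 drop0. Qed.

Lemma ncsM_rcons f g w j :
  (f * g) (rcons w j) = (f * dr j g) w + f (rcons w j) * g [::].
Proof.
elim: w f => [|i w IHw] f; last first.
  by rewrite !rcons_cons !ncsM_cons IHw addrA.
by rewrite ncsM_cons !ncsM_nil.
Qed.

Lemma ncsscaleAl c f g : c *: (f * g) = (c *: f) * g.
Proof.
apply: ncseriesP => w /=; rewrite mulr_sumr.
by apply: eq_bigr => i _; rewrite mulrA.
Qed.

Lemma ncsscaleAr c f g : c *: (f * g) = f * (c *: g).
Proof.
apply: ncseriesP => w /=; rewrite mulr_sumr.
by apply: eq_bigr => i _; rewrite mulrCA.
Qed.

Lemma dlM j f g : dl j (f * g) = f [::] *: dl j g + dl j f * g.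
Proof. by apply: ncseriesP => w; rewrite /= -ncsM_cons. Qed.

Lemma dlD j f g : dl j (f + g) = dl j f + dl j g. Proof. by []. Qed.
Lemma dl1 j : dl j 1 = 0. Proof. exact: ncseriesP. Qed.
Lemma dlz j i : dl j (ncz C i) = (j == i)%:R *: (1 : series).
Proof.
apply: ncseriesP => w; rewrite /= eqseq_cons.
by case: eqP => _ /=; rewrite ?mul0r ?mul1r.
Qed.

Lemma drM j f g : dr j (f * g) = f * dr j g + g [::] *: dr j f.
Proof.
apply: ncseriesP => w; rewrite ncsD ncsZ -[LHS]/((f * g) (rcons w j)).
by rewrite ncsM_rcons mulrC.
Qed.

Lemma zM_nil j f : (ncz C j * f) [::] = 0.
Proof. by rewrite ncsM_nil mul0r. Qed.

Lemma Mz_nil j f : (f * ncz C j) [::] = 0.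
Proof. by rewrite ncsM_nil mulr0. Qed.

Lemma zM_cons j f i w : (ncz C j * f) (i :: w) = (i == j)%:R * f w.
Proof. by rewrite ncsM_cons mul0r add0r dlz -ncsscaleAl mul1r. Qed.

Lemma drz j i : dr j (ncz C i) = (j == i)%:R *: (1 : series).
Proof.
apply: ncseriesP => -[|x w] /=; first by rewrite mulr1 eqseq_cons eqxx andbT.
by rewrite mulr0 eqseq_cons -size_eq0 size_rcons andbF.
Qed.

Lemma Mz_rcons j f i w : (f * ncz C j) (rcons w i) = (i == j)%:R * f w.
Proof. by rewrite ncsM_rcons mulr0 addr0 drz -ncsscaleAr mulr1. Qed.

Lemma sum_zdl f : \sum_j ncz C j * dl j f = f - f [::] *: (1 : series).
Proof.
apply: ncseriesP => -[|i w]; rewrite ncs_sum ncsB ncsZ ncs1E.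
  by rewrite mulr1 subrr big1 // => j _; rewrite zM_nil.
rewrite mulr0 subr0 (bigD1 i) // zM_cons eqxx mul1r big1 => [|j ne].
  exact: addr0.
by rewrite zM_cons eq_sym (negPf ne) mul0r.
Qed.

Lemma sum_drz f : \sum_j dr j f * ncz C j = f - f [::] *: (1 : series).
Proof.
apply: ncseriesP => w; case/lastP: w => [|w i]; rewrite ncs_sum ncsB ncsZ ncs1E.
  by rewrite mulr1 subrr big1 // => j _; rewrite Mz_nil.
rewrite -size_eq0 size_rcons mulr0 subr0 (bigD1 i) // Mz_rcons eqxx mul1r.
rewrite big1 => [|j ne]; first exact: addr0.
by rewrite Mz_rcons eq_sym (negPf ne) mul0r.
Qed.

Lemma sum_zM_inj (F F' : 'I_k -> series) :
  \sum_j ncz C j * F j = \sum_j ncz C j * F' j -> F =1 F'.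
Proof.
have E G i w : (\sum_j ncz C j * G j) (i :: w) = G i w.
  rewrite ncs_sum (bigD1 i) // zM_cons eqxx mul1r big1 => [|j ne].
    exact: addr0.
  by rewrite zM_cons eq_sym (negPf ne) mul0r.
by move=> eqF i; apply: ncseriesP => w; rewrite -E eqF E.
Qed.

Lemma sum_Mz_inj (F F' : 'I_k -> series) :
  \sum_j F j * ncz C j = \sum_j F' j * ncz C j -> F =1 F'.
Proof.
have E G i w : (\sum_j G j * ncz C j) (rcons w i) = G i w.
  rewrite ncs_sum (bigD1 i) // Mz_rcons eqxx mul1r big1 => [|j ne].
    exact: addr0.
  by rewrite Mz_rcons eq_sym (negPf ne) mul0r.
by move=> eqF i; apply: ncseriesP => w; rewrite -E eqF E.
Qed.

(** A factor without constant term leaves only shorter words to the other factor; this is the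
    locality that recursion on word length needs. *)
Lemma ncsM_contract f g g' v : f [::] = 0 ->
  (forall w, (size w < size v)%N -> g w = g' w) -> (f * g) v = (f * g') v.
Proof.
move=> f0 eqg; rewrite /= !big_ord_recl take0 f0 !mul0r; congr (_ + _).
case: v eqg => [|x v] eqg; first by rewrite !big_ord0.
by apply: eq_bigr => i _; rewrite eqg //= size_drop ltnS leq_subr.
Qed.

Lemma ncsM_contractl f g g' v : f [::] = 0 ->
  (forall w, (size w < size v)%N -> g w = g' w) -> (g * f) v = (g' * f) v.
Proof.
move=> f0 eqg; rewrite /= !big_ord_recr drop_size f0 !mulr0; congr (_ + _).
by apply: eq_bigr => i _; rewrite eqg //= size_take ltn_ord.
Qed.

(** The right inverse solves [g = 1 + f g], the left one [g' = 1 + g' f], and associativity makes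
    them equal. *)
Lemma unit1B f : f [::] = 0 -> 1 - f \is a GRing.unit.
Proof.
move=> f0.
pose F (e : seq 'I_k -> C) v := (1 + f * NCSeries e) v.
pose F' (e : seq 'I_k -> C) v := (1 + NCSeries e * f) v.
have [|g gE] := @word_fixpoint _ _ 0 F.
  by move=> e e' v ee'; rewrite /F !ncsD; congr (_ + _); apply: ncsM_contract.
have [|g' g'E] := @word_fixpoint _ _ 0 F'.
  by move=> e e' v ee'; rewrite /F' !ncsD; congr (_ + _); apply: ncsM_contractl.
have {}gE : (1 - f) * NCSeries g = 1.
  rewrite mulrBl mul1r; apply/eqP; rewrite subr_eq; apply/eqP.
  exact: ncseriesP.
have {}g'E : NCSeries g' * (1 - f) = 1.
  rewrite mulrBr mulr1; apply/eqP; rewrite subr_eq; apply/eqP.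
  exact: ncseriesP.
apply/unitrP; exists (NCSeries g); split => //.
suff <- : NCSeries g' = NCSeries g by [].
by rewrite -[LHS]mulr1 -gE mulrA g'E mul1r.
Qed.

Lemma unit1D f : f [::] = 0 -> 1 + f \is a GRing.unit.
Proof. by move=> f0; rewrite -[f]opprK; apply: unit1B; rewrite ncsN f0 oppr0. Qed.

Lemma subst_linear G c f g :
  ncsubst (c *: f + g) G = c *: ncsubst f G + ncsubst g G.
Proof.
apply: ncseriesP => v; rewrite /= mulr_sumr -big_split; apply: eq_bigr => n _.
rewrite /= mulr_sumr -big_split; apply: eq_bigr => w _.
by rewrite /= mulrDl mulrA.
Qed.

Lemma subst0 G : ncsubst 0 G = 0.
Proof.
apply: ncseriesP => v /=; rewrite big1 // => n _; rewrite big1 // => w _.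
exact: mul0r.
Qed.

Lemma substD G f g : ncsubst (f + g) G = ncsubst f G + ncsubst g G.
Proof. by rewrite -[f]scale1r subst_linear !scale1r. Qed.

Lemma substZ G c f : ncsubst (c *: f) G = c *: ncsubst f G.
Proof. by rewrite -[c *: f]addr0 subst_linear subst0 addr0. Qed.

Lemma substN G f : ncsubst (- f) G = - ncsubst f G.
Proof. by rewrite -scaleN1r substZ scaleN1r. Qed.

Lemma substB G f g : ncsubst (f - g) G = ncsubst f G - ncsubst g G.
Proof. by rewrite substD substN. Qed.

Lemma subst_sum G (J : Type) (r : seq J) (P : pred J) (F : J -> series) :
  ncsubst (\sum_(j <- r | P j) F j) G = \sum_(j <- r | P j) ncsubst (F j) G.
Proof. exact: (big_morph (fun f => ncsubst f G) (substD G) (subst0 G)). Qed.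

Lemma subst_nil G f : (ncsubst f G) [::] = f [::].
Proof.
rewrite /= big_ord1 (big_pred1 [tuple]) => [|w]; last exact/esym/eqP/tuple0.
by rewrite big_nil mulr1.
Qed.

(** * Algebraic laws of substitution *)

Section Subst.
Variable G : 'I_k -> series.
Hypothesis G0 : forall j, G j [::] = 0.

Lemma prod_small (w v : seq 'I_k) : (size v < size w)%N ->
  (\prod_(i <- w) G i : series) v = 0.
Proof.
elim: w v => // i w IHw v ltv; rewrite big_cons.
rewrite (@ncsM_contract _ _ 0) ?mulr0 // => u ltu.
by rewrite IHw //; apply: leq_trans ltu _.
Qed.

(** The contribution of the words of [f] of length [n]. It vanishes below degree [n], so the cutoff
    in [ncsubst] can be any bound above [size v]. *)
Let hom n f : series := \sum_(w : n.-tuple 'I_k) f w *: \prod_(i <- w) G i.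

Let homS n f : hom n.+1 f = \sum_j G j * hom n (dl j f).
Proof.
pose h (p : 'I_k * n.-tuple 'I_k) := [tuple of p.1 :: p.2].
pose h' (w : n.+1.-tuple 'I_k) := (thead w, [tuple of behead w]).
rewrite /hom (reindex h) /=; last first.
  exists h' => [[i w] _|w _]; last by rewrite [RHS]tuple_eta; apply: val_inj.
  by rewrite /h' /h theadE; congr (_, _); apply: val_inj.
under [RHS]eq_bigr do rewrite mulr_sumr.
rewrite pair_big; apply: eq_bigr => -[i w] _.
by rewrite /= big_cons ncsscaleAr.
Qed.

Let hom_small n f v : (size v < n)%N -> hom n f v = 0.
Proof.
move=> ltv; rewrite ncs_sum big1 // => w _.
by rewrite ncsZ prod_small ?mulr0 // size_tuple.
Qed.

Let substE f v N : (size v < N)%N -> ncsubst f G v = \sum_(n < N) hom n f v.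
Proof.
move=> ltv; rewrite -(subnKC ltv) big_split_ord /= [X in _ = _ + X]big1.
  rewrite addr0; apply: eq_bigr => n _; rewrite ncs_sum.
  by apply: eq_bigr => w _; rewrite ncsZ.
by move=> n _; rewrite hom_small //= addSn ltnS leq_addr.
Qed.

Lemma subst_rec f :
  ncsubst f G = f [::] *: (1 : series) + \sum_j G j * ncsubst (dl j f) G.
Proof.
apply: ncseriesP => v; rewrite (@substE _ _ (size v).+2) // big_ord_recl.
congr (_ + _).
  rewrite /hom (big_pred1 [tuple]) => [|w]; last exact/esym/eqP/tuple0.
  by rewrite big_nil.
under eq_bigr do rewrite /= homS ncs_sum.
rewrite exchange_big ncs_sum; apply: eq_bigr => j _.
rewrite -ncs_sum -mulr_sumr; apply: ncsM_contract => // w ltw.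
by rewrite ncs_sum (@substE _ _ (size v).+1) // ltnS ltnW.
Qed.

(** As [G j] has no constant term, [L x] at [v] is fixed by values at shorter words. Laws of
    substitution follow by checking that both sides obey one recursion; [X] is a state that each
    letter updates. *)
Lemma subst_rec_unique (X : Type) (d : 'I_k -> X -> X) (a : X -> series)
    (L L' : X -> series) :
    (forall x, L x = a x + \sum_j G j * L (d j x)) ->
    (forall x, L' x = a x + \sum_j G j * L' (d j x)) ->
  L =1 L'.
Proof.
move=> LE L'E x; apply: ncseriesP => v; move: v x.
apply: word_ind => v IHv x; rewrite LE L'E !ncsD !ncs_sum; congr (_ + _).
by apply: eq_bigr => j _; apply: ncsM_contract => // w /IHv.
Qed.

Lemma subst1 : ncsubst 1 G = 1.
Proof.
rewrite subst_rec scale1r big1 ?addr0 // => j _.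
by rewrite dl1 subst0 mulr0.
Qed.

Lemma substz i : ncsubst (ncz C i) G = G i.
Proof.
rewrite subst_rec scale0r add0r (bigD1 i) //= dlz eqxx scale1r subst1 mulr1.
rewrite big1 ?addr0 // => j ne.
by rewrite dlz (negPf ne) scale0r subst0 mulr0.
Qed.

Lemma substM f g : ncsubst (f * g) G = ncsubst f G * ncsubst g G.
Proof.
move: f; apply: (@subst_rec_unique _ dl (fun f => f [::] *: ncsubst g G)) => f.
  rewrite subst_rec ncsM_nil [ncsubst g G]subst_rec.
  under eq_bigr do rewrite dlM substD mulrDr substZ -ncsscaleAr.
  by rewrite big_split /= addrA scalerDr scalerA -scaler_sumr.
rewrite subst_rec mulrDl -ncsscaleAl mul1r; congr (_ + _).
by rewrite mulr_suml; apply: eq_bigr => j _; rewrite mulrA.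
Qed.

Lemma substV f : f \is a GRing.unit -> ncsubst f^-1 G = (ncsubst f G)^-1.
Proof.
move=> fU; have fgU : ncsubst f G \is a GRing.unit.
  apply/unitrP; exists (ncsubst f^-1 G).
  by rewrite -!substM mulVr // mulrV // subst1.
by apply: (mulrI fgU); rewrite -substM !mulrV // subst1.
Qed.

Lemma subst_recr f :
  ncsubst f G = f [::] *: (1 : series) + \sum_j ncsubst (dr j f) G * G j.
Proof.
have -> : \sum_j ncsubst (dr j f) G * G j = ncsubst (f - f [::] *: (1 : series)) G.
  rewrite -sum_drz subst_sum; apply: eq_bigr => j _.
  by rewrite substM substz.
by rewrite substB substZ subst1 addrC subrK.
Qed.

End Subst.

Lemma substA f G K : (forall j, G j [::] = 0) -> (forall j, K j [::] = 0) ->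
  ncsubst (ncsubst f G) K = ncsubst f (fun j => ncsubst (G j) K).
Proof.
move=> G0 K0; have GK0 j : ncsubst (G j) K [::] = 0 by rewrite subst_nil.
move: f.
apply: (@subst_rec_unique _ GK0 _ dl (fun f => f [::] *: (1 : series))) => f.
  rewrite [ncsubst f G]subst_rec // substD substZ subst1 // subst_sum.
  by under eq_bigr do rewrite substM //.
by rewrite [LHS]subst_rec.
Qed.

Lemma subst_id f : ncsubst f (@ncz C k) = f.
Proof.
move: f; apply: (@subst_rec_unique (@ncz C k) _ _ dl
  (fun f => f [::] *: (1 : series))) => // f.
  by rewrite subst_rec.
by rewrite sum_zdl addrC subrK.
Qed.

Lemma eq_subst f G G' : G =1 G' -> ncsubst f G = ncsubst f G'.
Proof. by move=> /funext ->. Qed.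

(** For [G j] of the form [z_j g], agreement of [g] on strictly shorter words is enough, so
    [word_fixpoint] applies to substitutions. *)
Lemma subst_local f G G' v :
  (forall j w, (size w <= size v)%N -> G j w = G' j w) ->
  ncsubst f G v = ncsubst f G' v.
Proof.
move=> eqG; have eqGw s u : (size u <= size v)%N ->
    (\prod_(i <- s) G i : series) u = (\prod_(i <- s) G' i : series) u.
  elim: s u => [|i s IHs] u leu; first by rewrite !big_nil.
  rewrite !big_cons; apply: eq_bigr => l _; congr (_ * _).
    by apply: eqG; rewrite size_take_min; apply: leq_trans leu; apply: geq_minr.
  by apply: IHs; rewrite size_drop; apply: leq_trans leu; apply: leq_subr.
by apply: eq_bigr => n _; apply: eq_bigr => w _; rewrite eqGw.
Qed.

End Series.

(** * The functional equation of B_t and boxed convolution *)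

Section BooleanFlow.
Variables (C : fieldType) (k : nat).
Local Notation series := (ncseries C k).
Local Notation z := (@ncz C k).
Implicit Types (f g h : series) (s t : C).

(* The graph of [eta_mu |-> eta_{B_t mu}]; for [t = 1] the pair [(f, h)] is
   [(R_mu, eta_mu)]. *)
Definition bflow t f h := [/\ f [::] = 0, h [::] = 0 &
  ncsubst f (fun j => z j * (1 - t *: h)^-1) = h * (1 - t *: h)^-1].

Lemma unit1BZ t h : h [::] = 0 -> 1 - t *: h \is a GRing.unit.
Proof. by move=> h0; apply: unit1B; rewrite ncsZ h0 mulr0. Qed.

Lemma invr1BZ t h : h [::] = 0 ->
  (1 - t *: h)^-1 = 1 + t *: (h * (1 - t *: h)^-1).
Proof.
move=> /(unit1BZ t) hU; apply: (mulIr hU).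
by rewrite mulVr // mulrDl mul1r -ncsscaleAl mulrVK // subrK.
Qed.

(** With [E = h (1 - t h)^-1] one has [(1 - t h)^-1 = 1 + t E], so the equation becomes the fixed
    point [E = f(z_j (1 + t E))], and [h = E (1 + t E)^-1]. *)
Lemma bflow_ex t f : f [::] = 0 -> exists h, bflow t f h.
Proof.
move=> f0.
pose F (e : seq 'I_k -> C) v :=
  ncsubst f (fun j => z j * (1 + t *: NCSeries e)) v.
have [|E /= EE] := @word_fixpoint _ _ 0 F.
  move=> e e' v ee'; apply: subst_local => j [|i w] ltw; first by rewrite !zM_nil.
  by rewrite !zM_cons !ncsD !ncsZ /= ee'.
have {}EE : NCSeries E = ncsubst f (fun j => z j * (1 + t *: NCSeries E)).
  exact: ncseriesP.
move: (NCSeries E) EE => {E} E EE.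
have E0 : E [::] = 0 by rewrite EE subst_nil.
have tE0 : (t *: E) [::] = 0 by rewrite ncsZ E0 mulr0.
have U := unit1D tE0.
exists (E * (1 + t *: E)^-1); rewrite /bflow.
have -> : 1 - t *: (E * (1 + t *: E)^-1) = (1 + t *: E)^-1.
  apply: (mulIr U).
  by rewrite mulVr // mulrBl mul1r -ncsscaleAl mulrVK // addrK.
by split; rewrite ?ncsM_nil ?E0 ?mul0r // invrK mulrVK // -EE.
Qed.

(** Substituting [w_j = z_j (1 - s g)^-1] in the equation for [f] and [h] sends [1 - t h] to
    [(1 - (t + s) g) (1 - s g)^-1]; the factors [(1 - s g)^-1] then cancel. *)
Lemma bflow_trans t s f h g : bflow t f h -> bflow s h g -> bflow (t + s) f g.
Proof.
move=> [f0 h0 fh] [_ g0 hg]; split => //.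
have sgU := unit1BZ s g0; have thU := unit1BZ t h0.
set w := fun j => z j * (1 - s *: g)^-1 in hg.
have w0 j : w j [::] = 0 by exact: zM_nil.
have /(congr1 (fun x => ncsubst x w)) := fh.
rewrite substA // => [|j]; last exact: zM_nil.
rewrite substM // substV // substB substZ subst1 // hg.
have E : 1 - t *: (g * (1 - s *: g)^-1) = (1 - (t + s) *: g) * (1 - s *: g)^-1.
  apply: (mulIr sgU); rewrite mulrBl mul1r -ncsscaleAl !mulrVK //.
  by rewrite scalerDl opprD addrA addrAC.
have sgV : (1 - s *: g)^-1 \is a GRing.unit by rewrite unitrV.
have tsU := unit1BZ (t + s) g0.
have Q : (1 - s *: g)^-1 * (1 - t *: (g * (1 - s *: g)^-1))^-1 =
    (1 - (t + s) *: g)^-1.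
  by rewrite E invrM // invrK mulKr.
rewrite -mulrA Q => <-; apply: eq_subst => j.
rewrite substM // substz // substV // substB substZ subst1 // hg.
by rewrite /w -mulrA Q.
Qed.

Lemma bflow0 f h : bflow 0 f h -> f = h.
Proof.
case=> _ _; rewrite scale0r subr0 invr1 mulr1 => <-.
rewrite -[LHS]subst_id; apply: eq_subst => j.
by rewrite mulr1.
Qed.

(** Flowing [h] for time [- t] gives a series at time 0 from [f], hence [f] itself. *)
Lemma bflow_sym t f h : bflow t f h -> bflow (- t) h f.
Proof.
move=> fh; have [_ h0 _] := fh; have [g hg] := bflow_ex (- t) h0.
by have := bflow_trans fh hg; rewrite subrr => /bflow0 ->.
Qed.

Lemma bflow_fun t f h h' : bflow t f h -> bflow t f h' -> h = h'.
Proof.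
by move=> /bflow_sym/bflow_trans fh /fh; rewrite addNr => /bflow0.
Qed.

Lemma bflow_inj t f f' h : bflow t f h -> bflow t f' h -> f = f'.
Proof. by move=> /bflow_sym fh /bflow_sym; apply: bflow_fun fh. Qed.

(* [1 + t h] and [1 - t h'] correspond to each other under the substitution
   relating [h] and [h'], which is thus inverted by [z_j (1 + t h)^-1]. *)
Lemma bflow_subst1 t h h' : bflow t h h' ->
  ncsubst (1 + t *: h)^-1 (fun j => z j * (1 - t *: h')^-1) = 1 - t *: h'.
Proof.
move=> [h0 h'0 hh']; rewrite substV ?unit1D ?ncsZ ?h0 ?mulr0 //.
  by rewrite substD substZ subst1 ?hh' -?invr1BZ ?invrK // => j; rewrite zM_nil.
by move=> j; rewrite zM_nil.
Qed.

(** In the reversed equation [f'(z_i (1 + t f)^-1) = f (1 + t f)^-1] the inverse ends every term; it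
    cancels, and last letters can be compared. *)
Lemma bflow_drE t f f' j : bflow t f f' ->
  ncsubst (dr j f') (fun i => z i * (1 + t *: f)^-1) = dr j f.
Proof.
move=> /bflow_sym[f'0 f0]; rewrite scaleNr opprK.
have U : 1 + t *: f \is a GRing.unit by rewrite unit1D // ncsZ f0 mulr0.
rewrite subst_recr => [|i]; last exact: zM_nil.
rewrite f'0 scale0r add0r; under eq_bigr do rewrite mulrA.
rewrite -mulr_suml => /mulIr; rewrite unitrV => /(_ U) fE; move: j.
by apply: sum_Mz_inj; rewrite fE sum_drz f0 scale0r subr0.
Qed.

(** Here the inverse stands between the first letter and the rest, so comparing first letters leaves
    a conjugation by [1 + t f]. *)
Lemma bflow_dlE t f f' j : bflow t f f' ->
  ncsubst (dl j f') (fun i => z i * (1 + t *: f)^-1) =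
    (1 + t *: f) * dl j f * (1 + t *: f)^-1.
Proof.
move=> /bflow_sym[f'0 f0]; rewrite scaleNr opprK.
have U : 1 + t *: f \is a GRing.unit by rewrite unit1D // ncsZ f0 mulr0.
rewrite subst_rec => [|i]; last exact: zM_nil.
rewrite f'0 scale0r add0r; under eq_bigr do rewrite -mulrA.
move=> fE; apply: (mulrI (x := (1 + t *: f)^-1)); first by rewrite unitrV.
rewrite -!mulrA mulKr //; move: j; apply: sum_zM_inj; rewrite fE.
under [RHS]eq_bigr do rewrite mulrA.
by rewrite -mulr_suml sum_zdl f0 scale0r subr0.
Qed.

(* Boxed convolution [h = f * g] through the generating series of the two
   kinds of gaps between consecutive elements of a block of a noncrossing
   partition or of its Kreweras complement. *)
Definition boxed_sol f g (A B : 'I_k -> series) :=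
  (forall j, A j = ncsubst (dl j g) (fun i => B i * z i)) /\
  (forall j, B j = ncsubst (dr j f) (fun i => z i * A i)).

Definition boxed f g h := exists A B, boxed_sol f g A B /\
  h = \sum_j B j * z j * A j.

(** The letters in [B_i z_i] and [z_i A_i] raise the degree by one, so both families are found
    together by recursion on word length. *)
Lemma boxed_sol_ex f g : exists A B, boxed_sol f g A B.
Proof.
pose sA (e : seq 'I_k -> ('I_k -> C) * ('I_k -> C)) i : series :=
  NCSeries (fun w => (e w).1 i).
pose sB (e : seq 'I_k -> ('I_k -> C) * ('I_k -> C)) i : series :=
  NCSeries (fun w => (e w).2 i).
pose F e v := (fun j => ncsubst (dl j g) (fun i => sB e i * z i) v,
               fun j => ncsubst (dr j f) (fun i => z i * sA e i) v).
have [|e eE] := @word_fixpoint _ _ (fun=> 0, fun=> 0) F.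
  move=> e e' v ee'; congr (_, _); apply: funext => j; apply: subst_local => i w.
    case/lastP: w => [|w x]; first by rewrite !Mz_nil.
    by rewrite size_rcons => ltw; rewrite !Mz_rcons /= ee'.
  case: w => [|x w] ltw; first by rewrite !zM_nil.
  by rewrite !zM_cons /= ee'.
by exists (sA e), (sB e); split => j; apply: ncseriesP => v; rewrite /= eE.
Qed.

Lemma boxed_sol_unique f g A B A' B' :
  boxed_sol f g A B -> boxed_sol f g A' B' -> A = A' /\ B = B'.
Proof.
move=> [AE BE] [A'E B'E].
suff AB : forall v j, A j v = A' j v /\ B j v = B' j v.
  by split; apply: funext => j; apply: ncseriesP => v; have [] := AB v j.
apply: word_ind => v IHv j; rewrite AE BE A'E B'E; split; apply: subst_local.
  move=> i w; case/lastP: w => [|w x]; first by rewrite !Mz_nil.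
  by rewrite size_rcons => ltw; rewrite !Mz_rcons (IHv _ _ i).2.
move=> i [|x w] ltw; first by rewrite !zM_nil.
by rewrite !zM_cons (IHv _ _ i).1.
Qed.

Lemma boxed_fun f g h h' : boxed f g h -> boxed f g h' -> h = h'.
Proof.
move=> [A [B [AB ->]]] [A' [B' [AB' ->]]].
by have [-> ->] := boxed_sol_unique AB AB'.
Qed.

(** Strip the last letters of [f] and insert the equation for [B]. Together with [boxed_substr],
    both substitutions yield the same boxed convolution. *)
Lemma boxed_substl f g A B : f [::] = 0 -> boxed_sol f g A B ->
  ncsubst f (fun i => z i * A i) = \sum_j B j * z j * A j.
Proof.
move=> f0 [AE BE]; rewrite subst_recr => [|i]; last exact: zM_nil.
rewrite f0 scale0r add0r; apply: eq_bigr => j _.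
by rewrite -BE mulrA.
Qed.

Lemma boxed_substr f g A B : g [::] = 0 -> boxed_sol f g A B ->
  ncsubst g (fun i => B i * z i) = \sum_j B j * z j * A j.
Proof.
move=> g0 [AE BE]; rewrite subst_rec => [|i]; last exact: Mz_nil.
by rewrite g0 scale0r add0r; apply: eq_bigr => j _; rewrite -AE.
Qed.

Lemma boxed_bflow t f f' g g' h h' : bflow t f f' -> bflow t g g' ->
  bflow t h h' -> boxed f g h -> boxed f' g' h'.
Proof.
move=> ff' gg' hh' [A [B [AB hE]]].
have [f0 _ _] := ff'; have [g0 _ _] := gg'; have [h0 h'0 hsub] := hh'.
have fG := boxed_substl f0 AB; have gH := boxed_substr g0 AB.
rewrite -hE in fG gH; have [AE BE] := AB.
pose u : series := 1 + t *: h; pose q : series := u^-1.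
pose om j := z j * (1 - t *: h')^-1.
have om0 j : om j [::] = 0 by apply: zM_nil.
have uU : u \is a GRing.unit by rewrite unit1D // ncsZ h0 mulr0.
have qom : ncsubst q om = 1 - t *: h' := bflow_subst1 hh'.
(* Thus [om] absorbs a factor [q] standing to the right of [z_j]. *)
have zq j : ncsubst (z j * q) om = z j.
  by rewrite substM // substz // qom mulrVK // unit1BZ.
have BE' j : ncsubst (dr j f') (fun i => z i * A i * q) = B j.
  rewrite BE -(bflow_drE _ ff') substA => [|i|i]; try exact: zM_nil.
  apply: eq_subst => i; have G0 x : (z x * A x) [::] = 0 by apply: zM_nil.
  rewrite substM // substz // substV // ?unit1D ?ncsZ ?f0 ?mulr0 //.
  by rewrite substD substZ subst1 // fG.
have AE' j : ncsubst (dl j g') (fun i => B i * z i * q) = u * A j * q.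
  have H0 x : (B x * z x) [::] = 0 by apply: Mz_nil.
  have gU : 1 + t *: g \is a GRing.unit by rewrite unit1D // ncsZ g0 mulr0.
  have uE : ncsubst (1 + t *: g) (fun i => B i * z i) = u.
    by rewrite substD substZ subst1 // gH.
  have := congr1 (fun x => ncsubst x (fun i => B i * z i)) (bflow_dlE j gg').
  rewrite !substM // substV // uE -AE substA // => [<-|i]; last exact: zM_nil.
  by apply: eq_subst => i; rewrite substM // substz // substV // uE.
(* The new pair is [u A_j q] and [B_j], both evaluated at [om]; inserting [q u = 1] between [z_j]
   and [A_j] yields the last two identities. *)
exists (fun j => ncsubst (u * A j * q) om), (fun j => ncsubst (B j) om).
split; [split|] => [j|j|].
- rewrite -AE' substA // => [|i]; last by rewrite ncsM_nil Mz_nil mul0r.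
  by apply: eq_subst => i; rewrite -mulrA substM // zq.
- rewrite -BE' substA // => [|i]; last by rewrite -mulrA zM_nil.
  apply: eq_subst => i; rewrite -[in RHS](zq i) -substM //; congr (ncsubst _ _).
  by rewrite -!mulrA mulKr.
transitivity (ncsubst (h * q) om).
  by rewrite substM // qom hsub mulrVK // unit1BZ.
rewrite hE mulr_suml subst_sum; apply: eq_bigr => j _.
rewrite -[in RHS](zq j) -!substM //; congr (ncsubst _ _).
by rewrite -!mulrA mulKr.
Qed.

End BooleanFlow.

(** * Distributions and their transforms *)

Section FreeAlgebra.
Variables (C : fieldType) (I : choiceType).

Lemma malg_scaleAr (c : C) (p q : {malg C[{fmonom I}]}) :
  c *: (p * q) = p * (c *: q).
Proof.
apply/malgP => u; rewrite mcoeffZ.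
rewrite (mcoeffMlw _ (fsubset_refl _) (fsubset_refl _)).
rewrite (mcoeffMlw _ (fsubset_refl _) (msuppZ_le _ _)).
rewrite mulr_sumr; apply: eq_bigr => m _; rewrite mulr_sumr.
by apply: eq_bigr => n _; rewrite mcoeffZ mulrnAr mulrCA.
Qed.

(* [monalg] declares [algType] structures on commutative monomials only. *)
Definition falg := {malg C[{fmonom I}]}.
HB.instance Definition _ := GRing.Lalgebra.on falg.
HB.instance Definition _ := GRing.Lalgebra_isAlgebra.Build C falg malg_scaleAr.

Definition fmon (w : seq I) : falg := << FMonom w >>.

Lemma fmon_nil : fmon [::] = 1.
Proof. by rewrite /fmon -fmoneE. Qed.

Lemma fmon_cat u w : fmon (u ++ w) = fmon u * fmon w.
Proof. by rewrite /fmon malgM_def fgmulUU mulr1 /mmul /= fmmulE. Qed.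

Lemma prod_fmu (w : seq I) : \prod_(i <- w) (<< fmu i >> : falg) = fmon w.
Proof.
elim: w => [|i w IHw]; first by rewrite big_nil fmon_nil.
by rewrite big_cons IHw fmuE -fmon_cat.
Qed.

Variable F : seq I -> C.

Definition fext : falg -> C := mmap idfun (fun m => F (fmonom_val m)).

Fact fext_is_scalar (c : C) (p q : {malg C[{fmonom I}]}) :
  fext (c *: p + q) = c * fext p + fext q.
Proof.
rewrite /fext raddfD /=; congr (_ + _).
rewrite (mmapEw (msuppZ_le _ _)) mmapE mulr_sumr; apply: eq_bigr => m _.
by rewrite mcoeffZ mulrA.
Qed.

HB.instance Definition _ := GRing.isLinear.Build C falg C *%R fext fext_is_scalar.

Lemma fext_fmon w : fext (fmon w) = F w.
Proof. by rewrite /fext mmapU mul1r. Qed.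

End FreeAlgebra.

Lemma fextE (C : fieldType) (I : choiceType) (a : {scalar {malg C[{fmonom I}]}}) p :
  a p = fext (fun w => a (fmon C w)) p.
Proof.
rewrite {1}[p]monalgE raddf_sum /fext mmapE; apply: eq_bigr => n _.
have -> : << p@_n *g n >> = p@_n *: fmon C n.
  by apply/malgP => u; rewrite mcoeffZ !mcoeffU fmK mulr_natr.
exact: linearZ.
Qed.

(** * Moment series, eta-series and R-transform *)

Section Distributions.
Variables (C : fieldType) (k : nat).
Local Notation series := (ncseries C k).
Implicit Types (mu nu rho : dist C k) (f g h : series) (t : C).

Lemma ncmonE w : ncmon C w = fmon C w :> falg C 'I_k.
Proof. exact: prod_fmu. Qed.

Lemma scalar_eqP (V : lmodType C) (a b : {scalar V}) : a =1 b -> a = b.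
Proof.
case: a b => [a [[a1] [a2]]] [b [[b1] [b2]]] /= /funext eqab.
case: _ / eqab in b1 b2 *.
by rewrite (Prop_irrelevance a1 b1) (Prop_irrelevance a2 b2).
Qed.

Lemma dist_eqP mu nu : (forall w, mu (ncmon C w) = nu (ncmon C w)) -> mu = nu.
Proof.
move=> eqmu.
have {}eqmu : dist_fun mu =1 dist_fun nu.
  have E : (fun w => dist_fun mu (fmon C w)) = (fun w => dist_fun nu (fmon C w)).
    by apply: funext => w; rewrite -ncmonE.
  by move=> p; rewrite (fextE (dist_fun mu)) (fextE (dist_fun nu)) E.
have {}eqmu := scalar_eqP eqmu.
case: mu nu eqmu => [m m1] [n n1] /= eqmn; case: _ / eqmn in n1 *.
by rewrite (Prop_irrelevance m1 n1).
Qed.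

Lemma dist_nil mu : mu (ncmon C [::]) = 1.
Proof. by rewrite /ncmon big_nil dist1. Qed.

Lemma dist_ex (F : seq 'I_k -> C) : F [::] = 1 ->
  exists mu : dist C k, forall w, mu (ncmon C w) = F w.
Proof.
move=> F1; have E1 : fext F (1 : falg C 'I_k) = 1 by rewrite -fmon_nil fext_fmon.
exists (@Dist C k (fext F : {scalar falg C 'I_k}) E1) => w.
by rewrite ncmonE /= fext_fmon.
Qed.

Lemma moment_nil mu : moment_series mu [::] = 0. Proof. by []. Qed.

Lemma moment1E mu w : (1 + moment_series mu) w = mu (ncmon C w).
Proof.
case: w => [|i w]; last by rewrite ncsD ncs1E add0r.
by rewrite ncsD moment_nil addr0 dist_nil.
Qed.

Lemma moment_inj mu nu : moment_series mu = moment_series nu -> mu = nu.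
Proof. by move=> eqM; apply: dist_eqP => w; rewrite -!moment1E eqM. Qed.

Lemma unit1_moment mu : 1 + moment_series mu \is a GRing.unit.
Proof. exact: unit1D. Qed.

Lemma eta_nil mu : eta_series mu [::] = 0.
Proof. by rewrite ncsM_nil mul0r. Qed.

Lemma invr1Beta mu : (1 - eta_series mu)^-1 = 1 + moment_series mu.
Proof.
suff -> : 1 - eta_series mu = (1 + moment_series mu)^-1 by rewrite invrK.
rewrite /eta_series -[X in X - _](mulrV (unit1_moment mu)) -mulrBl.
by rewrite addrK mul1r.
Qed.

Lemma eta_moment mu :
  eta_series mu * (1 - eta_series mu)^-1 = moment_series mu.
Proof. by rewrite invr1Beta mulrVK // unit1_moment. Qed.

Lemma eta_inj mu nu : eta_series mu = eta_series nu -> mu = nu.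
Proof. by move=> eqe; apply: moment_inj; rewrite -!eta_moment eqe. Qed.

(** Since [1 + M = (1 - h)^-1] is forced, the moments are the coefficients of this inverse, whose
    constant term is 1. *)
Lemma eta_ex h : h [::] = 0 -> exists mu, eta_series mu = h.
Proof.
move=> h0; have hU := unit1B h0.
pose F : seq 'I_k -> C := (1 - h)^-1.
have E : (1 - h)^-1 = 1 + h * (1 - h)^-1.
  by apply: (mulIr hU); rewrite mulVr // mulrDl mul1r mulrVK // subrK.
have F1 : F [::] = 1 by rewrite /F E ncsD ncsM_nil h0 mul0r addr0.
have [mu muE] := dist_ex F1; exists mu.
have M1 : 1 + moment_series mu = (1 - h)^-1.
  by apply: ncseriesP => w; rewrite moment1E muE.
have M : moment_series mu = h * (1 - h)^-1.
  by apply: (addrI (1 : series)); rewrite M1 -E.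
by rewrite /eta_series M1 M invrK mulrVK.
Qed.

(** The identities [(1 - eta)^-1 = 1 + M] and [eta (1 - eta)^-1 = M] turn the defining equation of
    the R-transform into the flow at time 1. *)
Lemma RtransformP mu f :
  (ncseries0 f /\ ncsubst f (fun i => ncz C i * (1 + moment_series mu)) =
     moment_series mu) <-> bflow 1 f (eta_series mu).
Proof.
rewrite /bflow !scale1r eta_moment invr1Beta; split=> [[f0 fM]|[f0 _ fM]] //.
by split; rewrite ?eta_nil.
Qed.

(** Flowing [eta_series mu] for time -1 provides a solution, so [xget] does not fall back on its
    default. *)
Lemma bflow_R mu : bflow 1 (R_transform mu) (eta_series mu).
Proof.
have [h] := bflow_ex (-1) (eta_nil mu).
move=> /bflow_sym; rewrite opprK => /RtransformP hR.
by apply/RtransformP; rewrite /R_transform; case: xgetP => [f _ //|/(_ h)].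
Qed.

Lemma R_transformE mu f : R_transform mu = f <-> bflow 1 f (eta_series mu).
Proof.
split=> [<-|]; first exact: bflow_R.
exact: bflow_inj (bflow_R mu).
Qed.

End Distributions.

(** * Free product of two distributions *)

Section GeneratedSubalgebra.
Variables (C : fieldType) (A : algType C) (S : set A).

Lemma subalg_closedP (B : set A) : GRing.subalg_closed [in B] <->
  [/\ B 1, forall c a b, B a -> B b -> B (c *: a + b) &
      forall a b, B a -> B b -> B (a * b)].
Proof.
split=> -[B1 BP BM]; split=> [|c a b aB bB|a b aB bB].
- exact: set_mem B1.
- by apply: set_mem; apply: BP; apply: mem_set.
- by apply: set_mem; apply: BM; apply: mem_set.
- exact: mem_set.
- by apply: mem_set; apply: BP; apply: set_mem.
- by apply: mem_set; apply: BM; apply: set_mem.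
Qed.

Lemma mem_gen_subalg a : S a -> gen_subalg S a.
Proof. by move=> aS B [_]; apply. Qed.

Lemma gen_subalg_sub (B : set A) : GRing.subalg_closed [in B] ->
  (forall a, S a -> B a) -> forall a, gen_subalg S a -> B a.
Proof. by move=> Bcl SB a; apply. Qed.

Lemma gen_subalg1 : gen_subalg S 1.
Proof. by move=> B [/subalg_closedP[]]. Qed.

Lemma gen_subalgM a b : gen_subalg S a -> gen_subalg S b -> gen_subalg S (a * b).
Proof.
move=> aS bS B BP; have [/subalg_closedP[_ _ +] _] := BP.
by apply; [apply: aS | apply: bS].
Qed.

Lemma gen_subalgP c a b :
  gen_subalg S a -> gen_subalg S b -> gen_subalg S (c *: a + b).
Proof.
move=> aS bS B BP; have [/subalg_closedP[_ + _] _] := BP.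
by apply; [apply: aS | apply: bS].
Qed.

Lemma gen_subalg0 : gen_subalg S 0.
Proof.
by have := gen_subalgP (-1) gen_subalg1 gen_subalg1; rewrite scaleN1r addNr.
Qed.

Lemma gen_subalgZ c a : gen_subalg S a -> gen_subalg S (c *: a).
Proof. by move=> aS; rewrite -[c *: a]addr0; apply: gen_subalgP gen_subalg0. Qed.

Lemma gen_subalgD a b : gen_subalg S a -> gen_subalg S b -> gen_subalg S (a + b).
Proof. by move=> aS bS; rewrite -[a]scale1r; apply: gen_subalgP. Qed.

Lemma gen_subalg_sum (J : Type) (r : seq J) (P : pred J) (F : J -> A) :
  (forall j, gen_subalg S (F j)) -> gen_subalg S (\sum_(j <- r | P j) F j).
Proof.
by move=> FS; elim/big_ind: _ => //; [apply: gen_subalg0 | apply: gen_subalgD].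
Qed.

End GeneratedSubalgebra.

(* [e_u], for a word [u], is the product of the maximal monochromatic runs [r] of
   [u], each centered to [r - m r]; these products form a basis of the free
   product. [lact x th] is the functional [e_u |-> th (x e_u)], where a
   functional [th] is given by its values on this basis. *)
Section FreeProduct.
Variables (C : fieldType) (L : choiceType) (clr : L -> bool) (m : seq L -> C).
Hypothesis m1 : m [::] = 1.
Implicit Types (th : seq L -> C) (u w : seq L) (b : bool).

Definition mono b w := all (fun x => clr x == b) w.
Definition starts b u := if u is x :: _ then clr x == b else false.

Let run b u := take (find (fun x => clr x != b) u) u.
Let rest b u := drop (find (fun x => clr x != b) u) u.

(** If [u] is a run [r] of the colour of [x] followed by [u'], then [x e_u = e_(xu) + m(xr) e_(u') -
    m(r) (e_(xu') + m(x) e_(u'))]. An empty [r] is not centered, so the last term is dropped. *)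
Definition lact x th : seq L -> C := fun u =>
  let r := run (clr x) u in let u' := rest (clr x) u in
  th (x :: u) + m (x :: r) * th u' -
  (if r is [::] then 0 else m r * (th (x :: u') + m [:: x] * th u')).

Definition act th w : seq L -> C := foldl (fun th' x => lact x th') th w.

Let run_cat b w u : mono b w -> ~~ starts b u ->
  run b (w ++ u) = w /\ rest b (w ++ u) = u.
Proof.
move=> wb ub; have E : find (fun x => clr x != b) (w ++ u) = size w.
  rewrite find_cat ifN; last first.
    by apply/hasPn => x /(allP wb) xb; rewrite negbK.
  by case: u ub => [|y u] /=; rewrite ?addn0 // => ->; rewrite addn0.
by rewrite /run /rest E take_size_cat // drop_size_cat.
Qed.

(** Split [w = (w - m w) + m w]: the centered part prefixes [w] to the basis word and is absent for
    empty [w]. *)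
Lemma act_mono b w th u : mono b w -> ~~ starts b u ->
  act th w u = (if w is [::] then 0 else th (w ++ u)) + m w * th u.
Proof.
move=> + ub; elim: w th => [|x w IHw] th; first by rewrite /= add0r m1 mul1r.
move=> /= /andP[/eqP xb wb].
rewrite [LHS]IHw // /lact xb /=; have [-> ->] := run_cat wb ub.
have [/= -> ->] := @run_cat b [::] u isT ub; rewrite subr0.
case: w {IHw wb} => [|y w] /=; first by rewrite m1 add0r mul1r.
by rewrite subrK.
Qed.

Lemma lact_linear x c th th' u :
  lact x (fun w => c * th w + th' w) u = c * lact x th u + lact x th' u.
Proof. by rewrite /lact; case: (run _ _) => [|j r]; ring. Qed.

Lemma act_linear w c th th' u :
  act (fun w => c * th w + th' w) w u = c * act th w u + act th' w u.
Proof.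
elim: w th th' => [//|x w IHw] th th'; rewrite /= -IHw; congr (act _ w u).
by apply: funext => v; rewrite lact_linear.
Qed.

(** The coordinate of the empty basis element, which serves as the state of the free product. *)
Definition vac u : C := (u == [::])%:R.

Definition aext th : falg C L -> C := fext (fun w => act th w [::]).

HB.instance Definition _ th :=
  GRing.Linear.copy (aext th) (fext (fun w => act th w [::])).

Lemma aext_linear c th th' p :
  aext (fun w => c * th w + th' w) p = c * aext th p + aext th' p.
Proof.
rewrite /aext /fext !mmapE mulr_sumr -big_split; apply: eq_bigr => n _ /=.
by rewrite act_linear mulrDr mulrCA.
Qed.

Lemma aext0 p : aext (fun=> 0) p = 0.
Proof.
have := aext_linear (-1) (fun=> 0) (fun=> 0) p.
have -> : (fun w : seq L => -1 * 0 + 0) = (fun=> 0 : C).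
  by apply: funext => w; rewrite mulr0 addr0.
by rewrite mulN1r addNr.
Qed.

Lemma aext_fmonM w th p : aext th (fmon C w * p) = aext (act th w) p.
Proof.
rewrite /aext [p]monalgE mulr_sumr !raddf_sum; apply: eq_bigr => n _ /=.
rewrite /fmon malgM_def fgmulUU mul1r /fext !mmapU /= fmM.
by rewrite /act foldl_cat.
Qed.

Lemma aext1 th : aext th 1 = th [::].
Proof. by rewrite -fmon_nil /aext fext_fmon. Qed.

Implicit Types l : seq (C * seq L).

Definition lcomb l : falg C L := \sum_(x <- l) x.1 *: fmon C x.2.

Lemma lcomb_cat l l' : lcomb (l ++ l') = lcomb l + lcomb l'.
Proof. by rewrite /lcomb big_cat. Qed.

Lemma lcombZ c l : lcomb [seq (c * x.1, x.2) | x <- l] = c *: lcomb l.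
Proof.
rewrite /lcomb big_map scaler_sumr; apply: eq_bigr => x _.
by rewrite scalerA.
Qed.

Let pact th l : seq L -> C := fun u => \sum_(x <- l) x.1 * act th x.2 u.

Lemma aext_lcombM l th p : aext th (lcomb l * p) = aext (pact th l) p.
Proof.
elim: l => [|[c r] l IHl].
  rewrite /lcomb big_nil mul0r linear0 -[LHS](aext0 p).
  by congr aext; apply: funext => u; rewrite /pact big_nil.
rewrite /lcomb big_cons mulrDl -scalerAl linearP /= IHl aext_fmonM.
rewrite -aext_linear; congr aext; apply: funext => u.
by rewrite /pact big_cons.
Qed.

Definition avoids b th := forall u, starts b u -> th u = 0.

(** As [th] kills words starting with colour [b], only the scalar term of [act_mono] survives, and
    the combination acts through its expectation. *)
Let pact_avoids th b l u : {in l, forall x, mono b x.2} ->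
    avoids b th -> ~~ starts b u ->
  pact th l u = (\sum_(x <- l) x.1 * m x.2) * th u.
Proof.
move=> lb thb ub; rewrite mulr_suml /pact !big_seq.
apply: eq_bigr => -[c w] /lb /= wb; rewrite (act_mono _ wb ub) -mulrA.
case: w wb => [|i w /andP[ib _]]; first by rewrite add0r.
by rewrite thb /= ?ib // add0r.
Qed.

Lemma avoids_vac b : avoids b vac.
Proof. by case. Qed.

Definition mono_span b : set (falg C L) :=
  [set p | exists2 l, {in l, forall x, mono b x.2} & p = lcomb l]%classic.

(* Multiplying by centered elements of alternating colours keeps the functional
   supported away from the next colour. *)
Lemma aext_alternating (s : seq (bool * falg C L)) th :
    s != [::] -> sorted (fun p q => p.1 != q.1) s ->
    avoids (head true (unzip1 s)) th ->
    {in s, forall p, mono_span p.1 p.2 /\ aext vac p.2 = 0} ->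
  aext th (\prod_(p <- s) p.2) = 0.
Proof.
elim: s th => // -[b p] s IHs th _ /= srt thb sP.
have [[l /= lb pE] p0] := sP _ (mem_head _ _).
have l0 : \sum_(x <- l) x.1 * m x.2 = 0.
  move: p0; rewrite /= pE -[lcomb l]mulr1 aext_lcombM aext1.
  by rewrite (pact_avoids lb (@avoids_vac b)) // mulr1.
have ub u : ~~ starts b u -> pact th l u = 0.
  by move=> ub; rewrite (pact_avoids lb) // l0 mul0r.
rewrite big_cons /= pE aext_lcombM.
case: s IHs srt sP => [|[b' q] s] IHs /= srt sP; first by rewrite big_nil aext1 ub.
case/andP: srt => bb' srt; apply: IHs => //.
  move=> [//|y u] /= /eqP yb; apply: ub => /=.
  by rewrite yb eq_sym.
by move=> x xs; apply: sP; rewrite in_cons xs orbT.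
Qed.

Lemma mono_span_subalg b : GRing.subalg_closed [in mono_span b].
Proof.
apply/subalg_closedP; split=> [|c _ _ [l lb ->] [l' l'b ->]|].
- exists [:: (1, [::])]; first by move=> x; rewrite inE => /eqP ->.
  by rewrite /lcomb big_seq1 scale1r fmon_nil.
- exists ([seq (c * x.1, x.2) | x <- l] ++ l').
    move=> x; rewrite mem_cat => /orP[/mapP[y yl ->]|]; last exact: l'b.
    exact: lb yl.
  by rewrite lcomb_cat lcombZ.
move=> _ _ [l lb ->] [l' l'b ->].
exists [seq (x.1 * y.1, x.2 ++ y.2) | x <- l, y <- l'].
  move=> _ /allpairsP[[x y] /= [xl yl ->]] /=.
  by rewrite /mono all_cat [all _ _](lb _ xl) [all _ _](l'b _ yl).
rewrite /lcomb big_allpairs_dep mulr_suml; apply: eq_bigr => x _.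
rewrite mulr_sumr; apply: eq_bigr => y _.
by rewrite -scalerAl -scalerAr scalerA fmon_cat.
Qed.

Definition free_ncps : ncps C :=
  @NCPS C (falg C L) (aext vac : {scalar falg C L}) (aext1 vac).

Definition letter x : free_ncps := fmon C [:: x].

Lemma prod_letter w : \prod_(x <- w) letter x = fmon C w.
Proof.
elim: w => [|i r IHr]; first by rewrite big_nil fmon_nil.
by rewrite big_cons IHr -fmon_cat.
Qed.

Lemma free_ncps_free : freely_independent
  (fun b => [set letter x | x in [set x | clr x = b]]%classic).
Proof.
move=> s s0 srt sP; apply: aext_alternating => // [|p ps].
  exact: avoids_vac.
have [pS p0] := sP p ps; split=> //.
apply: gen_subalg_sub (@mono_span_subalg p.1) _ _ pS => _ [x xp <-].
exists [:: (1, [:: x])]; last first.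
  by rewrite /lcomb big_seq1 scale1r.
by move=> y; rewrite inE => /eqP -> /=; rewrite xp eqxx.
Qed.

Lemma free_ncps_mono b w : mono b w ->
  ncps_exp free_ncps (\prod_(x <- w) letter x) = m w.
Proof.
move=> wb; rewrite prod_letter /= /aext fext_fmon (act_mono _ wb) // mulr1.
by case: w wb => [|x w]; rewrite add0r.
Qed.

End FreeProduct.

(** * Existence of the free multiplicative convolution *)

Section FreeMulConvExistence.
Variables (C : fieldType) (k : nat).

Lemma is_free_mul_conv_ex (mu nu : dist C k) :
  exists rho, is_free_mul_conv mu nu rho.
Proof.
pose L : choiceType := (bool * 'I_k)%type.
pose clr (x : L) : bool := x.1.
(* Only words of one colour matter, so the first letter selects the marginal; the empty word has
   value 1 for both. *)
pose m (w : seq L) : C :=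
  if w is (false, _) :: _ then nu (ncmon C (unzip2 w)) else mu (ncmon C (unzip2 w)).
have m1 : m [::] = 1 by apply: dist_nil.
pose A := free_ncps clr m.
pose x i : A := letter clr m (true, i); pose y i : A := letter clr m (false, i).
have [rho rhoE] := dist_ex
  (F := fun w => ncps_exp A (\prod_(i <- w) (x i * y i)))
  (etrans (congr1 _ (big_nil _ _ _ _)) (ncps_exp1 A)).
have marg b (w : seq 'I_k) :
    ncps_exp A (\prod_(i <- w) letter clr m (b, i)) = m [seq (b, i) | i <- w].
  rewrite -(@free_ncps_mono _ _ clr _ m1 b) ?big_map //.
  by apply/allP => _ /mapP[i _ ->] /=.
have unz b (w : seq 'I_k) : unzip2 [seq (b, i) | i <- w] = w.
  by rewrite /unzip2 -map_comp map_id.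
exists rho, A, x, y; split=> // [w|w|].
- by rewrite marg /m unz; case: w.
- by rewrite marg /m unz; case: w => //=; rewrite !dist_nil.
have := @free_ncps_free _ _ clr _ m1; congr freely_independent.
apply: funext => b; rewrite eqEsubset; split; last first.
  by case: b => _ [i _ <-]; [exists (true, i) | exists (false, i)].
by move=> _ [[c i] /= <- <-]; case: c; exists i.
Qed.

End FreeMulConvExistence.

(** * Power series with coefficients in an algebra *)

(* The coefficients commute with the indeterminates. *)
Record aseries (A : nzRingType) (I : Type) := ASeries { acoef :> seq I -> A }.

HB.instance Definition _ A I := gen_eqMixin (aseries A I).
HB.instance Definition _ A I := gen_choiceMixin (aseries A I).

Section AlgebraSeries.
Variables (A : nzRingType) (I : Type).
Local Notation series := (aseries A I).
Implicit Types (f g h : series) (w : seq I) (a : A).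

Lemma aseriesP f g : (forall w, f w = g w) -> f = g.
Proof. by case: f g => [f] [g] /= /funext ->. Qed.

Definition aszero : series := ASeries (fun=> 0).
Definition asopp f : series := ASeries (fun w => - f w).
Definition asadd f g : series := ASeries (fun w => f w + g w).
Definition asone : series := ASeries (fun w => if w is [::] then 1 else 0).
Definition asmul f g : series := ASeries (fun w =>
  \sum_(i < (size w).+1) f (take i w) * g (drop i w)).

Fact asaddA : associative asadd.
Proof. by move=> f g h; apply: aseriesP => w /=; rewrite addrA. Qed.
Fact asaddC : commutative asadd.
Proof. by move=> f g; apply: aseriesP => w /=; rewrite addrC. Qed.
Fact asadd0 : left_id aszero asadd.
Proof. by move=> f; apply: aseriesP => w /=; rewrite add0r. Qed.
Fact asaddN : left_inverse aszero asopp asadd.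
Proof. by move=> f; apply: aseriesP => w /=; rewrite addNr. Qed.

HB.instance Definition _ :=
  GRing.isZmodule.Build series asaddA asaddC asadd0 asaddN.

Definition adl (x : I) f : series := ASeries (fun w => f (x :: w)).

Lemma asmul_nil f g : asmul f g [::] = f [::] * g [::].
Proof. by rewrite /= big_ord1. Qed.

Lemma asmul_cons f g x w :
  asmul f g (x :: w) = f [::] * g (x :: w) + asmul (adl x f) g w.
Proof. by rewrite /= big_ord_recl. Qed.

Fact asmulDl : left_distributive asmul +%R.
Proof.
move=> f g h; apply: aseriesP => w /=; rewrite -big_split /=.
by apply: eq_bigr => i _; rewrite mulrDl.
Qed.
Fact asmulDr : right_distributive asmul +%R.
Proof.
move=> f g h; apply: aseriesP => w /=; rewrite -big_split /=.
by apply: eq_bigr => i _; rewrite mulrDr.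
Qed.
Fact asmulA : associative asmul.
Proof.
move=> f g h; apply: aseriesP => w; elim: w f => [|x w IHw] f.
  by rewrite !asmul_nil mulrA.
rewrite [LHS]asmul_cons [RHS]asmul_cons !asmul_nil asmul_cons mulrDr -addrA mulrA.
congr (_ + _); rewrite IHw.
have -> : adl x (asmul f g) =
    ASeries (fun w => f [::] * g (x :: w)) + asmul (adl x f) g.
  by apply: aseriesP => u; rewrite [LHS]asmul_cons.
rewrite asmulDl; congr (_ + _) => /=.
by rewrite mulr_sumr; apply: eq_bigr => i _; rewrite mulrA.
Qed.
Fact asmul1 : left_id asone asmul.
Proof.
move=> f; apply: aseriesP => -[|x w]; first by rewrite asmul_nil mul1r.
rewrite asmul_cons mul1r [X in _ + X]big1 ?addr0 // => i _.
exact: mul0r.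
Qed.
Fact asmulr1 : right_id asone asmul.
Proof.
move=> f; apply: aseriesP => w; elim: w f => [|x w IHw] f.
  by rewrite asmul_nil mulr1.
by rewrite asmul_cons mulr0 add0r IHw.
Qed.
Fact asone_neq0 : asone != 0.
Proof.
apply/eqP => /(congr1 (fun f : series => f [::])) /=.
by apply/eqP; rewrite oner_eq0.
Qed.

HB.instance Definition _ := GRing.Zmodule_isNzRing.Build series
  asmulA asmul1 asmulr1 asmulDl asmulDr asone_neq0.

Lemma asD f g w : (f + g) w = f w + g w. Proof. by []. Qed.
Lemma asN f w : (- f) w = - f w. Proof. by []. Qed.
Lemma asME f g w :
  (f * g) w = \sum_(i < (size w).+1) f (take i w) * g (drop i w).
Proof. by []. Qed.
Lemma asM_nil f g : (f * g) [::] = f [::] * g [::].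
Proof. exact: asmul_nil. Qed.
Lemma asM_cons f g x w :
  (f * g) (x :: w) = f [::] * g (x :: w) + (adl x f * g) w.
Proof. exact: asmul_cons. Qed.

Lemma as_sum (J : Type) (r : seq J) (P : pred J) (F : J -> series) w :
  (\sum_(j <- r | P j) F j) w = \sum_(j <- r | P j) F j w.
Proof. by elim/big_rec2: _ => // j x y _ <-. Qed.

Definition asC a : series := ASeries (fun w => if w is [::] then a else 0).

Lemma asCM a f w : (asC a * f) w = a * f w.
Proof.
case: w => [|x w]; first by rewrite asM_nil.
rewrite asM_cons asME big1 ?addr0 // => i _.
exact: mul0r.
Qed.

Lemma asMC a f w : (f * asC a) w = f w * a.
Proof.
elim: w f => [|x w IHw] f; first by rewrite asM_nil.
by rewrite asM_cons mulr0 add0r IHw.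
Qed.

Lemma asCC a b : asC a * asC b = asC (a * b).
Proof. by apply: aseriesP => -[|x w]; rewrite asCM //= mulr0. Qed.

Lemma asC1 : asC 1 = 1. Proof. by []. Qed.

Lemma asM_contract f g g' v : f [::] = 0 ->
  (forall w, (size w < size v)%N -> g w = g' w) -> (f * g) v = (f * g') v.
Proof.
move=> f0 eqg; rewrite /= !big_ord_recl take0 f0 !mul0r; congr (_ + _).
case: v eqg => [|x v] eqg; first by rewrite !big_ord0.
by apply: eq_bigr => i _; rewrite eqg //= size_drop ltnS leq_subr.
Qed.

Lemma asM_contractl f g g' v : f [::] = 0 ->
  (forall w, (size w < size v)%N -> g w = g' w) -> (g * f) v = (g' * f) v.
Proof.
move=> f0 eqg; rewrite /= !big_ord_recr drop_size f0 !mulr0; congr (_ + _).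
by apply: eq_bigr => i _; rewrite eqg //= size_take ltn_ord.
Qed.

Lemma asinv_ex f : f [::] = 0 -> exists g, (1 - f) * g = 1 /\ g * (1 - f) = 1.
Proof.
move=> f0.
pose F (e : seq I -> A) v := (1 + f * ASeries e) v.
pose F' (e : seq I -> A) v := (1 + ASeries e * f) v.
have [|g gE] := @word_fixpoint _ _ 0 F.
  by move=> e e' v ee'; rewrite /F !asD; congr (_ + _); apply: asM_contract.
have [|g' g'E] := @word_fixpoint _ _ 0 F'.
  by move=> e e' v ee'; rewrite /F' !asD; congr (_ + _); apply: asM_contractl.
have {}gE : (1 - f) * ASeries g = 1.
  rewrite mulrBl mul1r; apply/eqP; rewrite subr_eq; apply/eqP.
  exact: aseriesP.
have {}g'E : ASeries g' * (1 - f) = 1.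
  rewrite mulrBr mulr1; apply/eqP; rewrite subr_eq; apply/eqP.
  exact: aseriesP.
exists (ASeries g); split => //.
suff <- : ASeries g' = ASeries g by [].
by rewrite -[LHS]mulr1 -gE mulrA g'E mul1r.
Qed.

End AlgebraSeries.

(** * Scalar series and coefficientwise expectation *)

Section ScalarSeries.
Variables (C : fieldType) (A : algType C) (k : nat).
Local Notation aser := (aseries A 'I_k).
Implicit Types (f g : ncseries C k) (s t : aser) (a : A).

(** Scalar series embedded through multiples of the unit; they commute with the constants [asC], but
    in general not with each other. *)
Definition sas f : aser := ASeries (fun w => f w *: 1).

Lemma sasM f s w : (sas f * s) w =
  \sum_(i < (size w).+1) f (take i w) *: s (drop i w).
Proof. by apply: eq_bigr => i _; rewrite /= -scalerAl mul1r. Qed.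

Lemma Msas f s w : (s * sas f) w =
  \sum_(i < (size w).+1) f (drop i w) *: s (take i w).
Proof. by apply: eq_bigr => i _; rewrite /= -scalerAr mulr1. Qed.

Fact sas_zmod : zmod_morphism sas.
Proof. by move=> f g; apply: aseriesP => w; rewrite /= scalerBl. Qed.

Fact sas_mon : monoid_morphism sas.
Proof.
split=> [|f g]; apply: aseriesP => w.
  by case: w => [|x w]; rewrite /= ?scale1r ?scale0r.
rewrite sasM /= scaler_suml; apply: eq_bigr => i _.
by rewrite scalerA.
Qed.

HB.instance Definition _ :=
  GRing.isZmodMorphism.Build (ncseries C k) aser sas sas_zmod.
HB.instance Definition _ :=
  GRing.isMonoidMorphism.Build (ncseries C k) aser sas sas_mon.

Lemma sasC f a : sas f * asC _ a = asC _ a * sas f.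
Proof.
by apply: aseriesP => w; rewrite asCM asMC /= -scalerAl -scalerAr mul1r mulr1.
Qed.

Variable phi : {scalar A}.

Definition expect s : ncseries C k := NCSeries (fun w => phi (s w)).

Lemma expectD s t : expect (s + t) = expect s + expect t.
Proof. by apply: ncseriesP => w; rewrite /= raddfD. Qed.

Lemma expectB s t : expect (s - t) = expect s - expect t.
Proof. by apply: ncseriesP => w; rewrite /= raddfB. Qed.

Lemma expect_sum (J : Type) (r : seq J) (P : pred J) (F : J -> aser) :
  expect (\sum_(j <- r | P j) F j) = \sum_(j <- r | P j) expect (F j).
Proof.
by apply: ncseriesP => w; rewrite ncs_sum /= as_sum raddf_sum.
Qed.

Lemma expect_sasM f s : expect (sas f * s) = f * expect s.
Proof.
apply: ncseriesP => w; rewrite [LHS](congr1 phi (sasM f s w)) raddf_sum.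
by apply: eq_bigr => i _; apply: linearZ.
Qed.

Lemma expect_Msas f s : expect (s * sas f) = expect s * f.
Proof.
apply: ncseriesP => w; rewrite [LHS](congr1 phi (Msas f s w)) raddf_sum.
by apply: eq_bigr => i _; rewrite /= mulrC; apply: linearZ.
Qed.

Lemma expectC a : expect (asC _ a) = phi a *: (1 : ncseries C k).
Proof.
by apply: ncseriesP => -[|x w]; rewrite /= ?mulr1 // mulr0 raddf0.
Qed.

(** Unfolding [U = 1 + sum_j G_j x_j U] once moves a letter into [a], so both sides obey the
    recursion of [subst_rec_unique] with state [a] updated to [a x_j]. *)
Lemma expect_resolvent (G : 'I_k -> ncseries C k) (x : 'I_k -> A) (U : aser) a b :
    (forall j, G j [::] = 0) ->
    (1 - \sum_j sas (G j) * asC _ (x j)) * U = 1 ->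
  expect (asC _ a * U * asC _ b) =
    ncsubst (NCSeries (fun w => phi (a * \prod_(i <- w) x i * b))) G.
Proof.
move=> G0 UE; have {}UE : U = 1 + \sum_j sas (G j) * asC _ (x j) * U.
  by move: UE; rewrite mulrBl mul1r => /eqP; rewrite subr_eq mulr_suml => /eqP.
move: a; apply: (@subst_rec_unique _ _ G G0 _ (fun j a => a * x j)
  (fun a => phi (a * b) *: (1 : ncseries C k))) => a.
  rewrite [in LHS]UE mulrDr mulrDl mulr1 asCC expectD expectC; congr (_ + _).
  rewrite mulr_sumr mulr_suml expect_sum; apply: eq_bigr => j _.
  by rewrite -expect_sasM !mulrA -sasC -!mulrA (mulrA (asC _ a)) asCC.
rewrite subst_rec // /= big_nil mulr1; congr (_ + _); apply: eq_bigr => j _.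
by congr (_ * ncsubst _ G); apply: ncseriesP => w; rewrite /= big_cons !mulrA.
Qed.

End ScalarSeries.

(** * The eta-series of a free multiplicative convolution *)

Section AlternatingExpectation.
Variables (C : fieldType) (k : nat) (A : ncps C) (S : bool -> set A).
Hypothesis free : freely_independent S.
Local Notation aser := (aseries A 'I_k).
Local Notation phi := (ncps_exp A).
Local Notation expect := (expect phi).
Implicit Types (f : ncseries C k) (s t : aser) (c : bool) (n : nat).

Definition centered c t := forall w, gen_subalg (S c) (t w) /\ phi (t w) = 0.

Let alternating c (l : seq (bool * A)) :=
  [/\ l != [::], sorted (fun p q => p.1 != q.1) l, last c (unzip1 l) = c
    & {in l, forall p, gen_subalg (S p.1) p.2 /\ phi p.2 = 0}].

(** Any alternating centered product ending in colour [c] has expectation zero when multiplied by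
    [s], in degrees below [n]. The bound permits induction on degree for a series given only
    implicitly. *)
Definition follows c n s := forall l, alternating c l ->
  forall w, (size w < n)%N -> phi ((\prod_(p <- l) p.2) * s w) = 0.

Let alternating1 c t w : centered c t -> alternating c [:: (c, t w)].
Proof. by move=> tc; split=> // p; rewrite inE => /eqP ->; apply: tc. Qed.

Let alternating_rcons c t w l : centered (~~ c) t -> alternating c l ->
  alternating (~~ c) (rcons l (~~ c, t w)).
Proof.
move=> tc [l0 lalt llast lP]; split.
- by rewrite -size_eq0 size_rcons.
- case: l l0 lalt llast {lP} => // p l _ /= lalt llast.
  rewrite rcons_path lalt /=; rewrite last_map in llast; rewrite llast.
  by case: c {tc llast}.
- by rewrite /unzip1 map_rcons last_rcons.
by move=> p; rewrite mem_rcons inE => /predU1P[->|/lP //]; apply: tc.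
Qed.

Let phi_alternating c l : alternating c l -> phi (\prod_(p <- l) p.2) = 0.
Proof. by case=> l0 lalt _ lP; apply: free. Qed.

Lemma follows1 c n : follows c n 1.
Proof.
move=> l la [|x w] _; first by rewrite mulr1 (phi_alternating la).
by rewrite mulr0 raddf0.
Qed.

Lemma followsD c n s t : follows c n s -> follows c n t -> follows c n (s + t).
Proof. by move=> hs ht l la w lw; rewrite mulrDr raddfD /= hs // ht // addr0. Qed.

Lemma followsN c n s : follows c n s -> follows c n (- s).
Proof. by move=> hs l la w lw; rewrite mulrN raddfN /= hs // oppr0. Qed.

Lemma follows_sum c n (F : 'I_k -> aser) :
  (forall j, follows c n (F j)) -> follows c n (\sum_j F j).
Proof.
move=> hF l la w lw; rewrite as_sum mulr_sumr raddf_sum big1 // => j _.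
exact: hF.
Qed.

Let phiZ (p : A) d a : phi (p * (d *: a)) = d * phi (p * a).
Proof. by rewrite -scalerAr; apply: linearZ. Qed.

Lemma follows_sasM c n f s : follows c n s -> follows c n (sas A f * s).
Proof.
move=> hs l la w lw; rewrite sasM mulr_sumr raddf_sum big1 // => i _.
rewrite [LHS]phiZ hs ?mulr0 // size_drop.
by apply: leq_ltn_trans lw; apply: leq_subr.
Qed.

(** Without constant term, [f] consumes a letter before [s] is reached; this gain drives the
    induction on degree. *)
Lemma follows_sasM0 c n f s : f [::] = 0 -> follows c n s ->
  follows c n.+1 (sas A f * s).
Proof.
move=> f0 hs l la w lw; rewrite sasM mulr_sumr raddf_sum big1 // => i _.
rewrite [LHS]phiZ; case: i => -[|i] /= ilt; first by rewrite take0 f0 mul0r.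
rewrite hs ?mulr0 // size_drop; case: w lw ilt => //= x w lw _.
by rewrite subSS; apply: leq_ltn_trans (leq_subr _ _) _; apply: lw.
Qed.

Lemma follows_Msas c n f s : follows c n s -> follows c n (s * sas A f).
Proof.
move=> hs l la w lw; rewrite Msas mulr_sumr raddf_sum big1 // => i _.
rewrite [LHS]phiZ hs ?mulr0 // size_take_min.
by apply: leq_ltn_trans lw; apply: geq_minr.
Qed.

Lemma follows_centered c n t : centered (~~ c) t -> follows c n t.
Proof.
move=> tc l la w _; have := phi_alternating (alternating_rcons w tc la).
by rewrite big_rcons.
Qed.

Lemma follows_centeredM c n t s : centered (~~ c) t -> follows (~~ c) n s ->
  follows c n (t * s).
Proof.
move=> tc hs l la w lw; rewrite asME mulr_sumr raddf_sum big1 // => i _.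
have /hs := alternating_rcons (take i w) tc la.
move=> /(_ (drop i w)); rewrite big_rcons /= mulrA; apply.
by rewrite size_drop; apply: leq_ltn_trans lw; apply: leq_subr.
Qed.

Lemma expect_centered c t : centered c t -> expect t = 0.
Proof. by move=> tc; apply: ncseriesP => w; have [] := tc w. Qed.

Lemma expect_centeredM c t s : centered c t -> (forall n, follows c n s) ->
  expect (t * s) = 0.
Proof.
move=> tc hs; apply: ncseriesP => w.
rewrite /= raddf_sum big1 // => i _.
have := hs _ _ (alternating1 (take i w) tc) (drop i w) (ltnSn _).
by rewrite big_seq1.
Qed.

End AlternatingExpectation.

(** * Freeness turns into boxed convolution *)

Section FreeMulConvBoxed.
Variables (C : fieldType) (k : nat) (mu nu rho : dist C k).

(** In [T = 1 + sum_j F_j a_j T] the series [F_j] lack a constant term, so each coefficient of [T]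
    is built from those at shorter words. *)
Lemma resolvent_mem (A : algType C) (S : set A) (F : 'I_k -> ncseries C k)
    (a : 'I_k -> A) (T : aseries A 'I_k) :
    (forall j, F j [::] = 0) -> (forall j, S (a j)) ->
    (1 - \sum_j sas A (F j) * asC _ (a j)) * T = 1 ->
  forall w, gen_subalg S (T w).
Proof.
move=> F0 aS TE.
have {}TE : T = 1 + \sum_j sas A (F j) * (asC _ (a j) * T).
  move: TE; rewrite mulrBl mul1r mulr_suml => /eqP; rewrite subr_eq => /eqP {1}->.
  by congr (_ + _); apply: eq_bigr => j _; rewrite mulrA.
apply: word_ind => w IHw; rewrite TE asD; apply: gen_subalgD.
  by case: w {IHw} => [|? ?]; [apply: gen_subalg1 | apply: gen_subalg0].
rewrite as_sum; apply: gen_subalg_sum => j; rewrite sasM.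
apply: gen_subalg_sum => i; rewrite asCM; case: i => -[|i] /= ilt.
  by rewrite take0 F0 scale0r; apply: gen_subalg0.
apply: gen_subalgZ; apply: gen_subalgM.
  exact: mem_gen_subalg.
apply: IHw; rewrite size_drop; case: w ilt => //= x w _.
by rewrite subSS ltnS leq_subr.
Qed.

(* With [U], [V] the resolvents of [sum_j x_j G_j] and [sum_j H_j y_j], where
   [G_j = z_j A_j] and [H_j = B_j z_j], the series [a_j = (1 - h) U x_j - B_j]
   and [b_j = y_j V (1 - h) - A_j] are centered, and
     (1 - h) U (1 - sum_j x_j z_j y_j) V (1 - h) = 1 - h - c
   for a combination [c] of the products [a_i b_j]. By freeness only [1 - h]
   contributes to the expectation of the inverse. *)
Lemma free_mul_conv_boxed : is_free_mul_conv mu nu rho ->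
  boxed (eta_series mu) (eta_series nu) (eta_series rho).
Proof.
move=> [A [x [y [xmu ynu free xyrho]]]].
set S := (fun b : bool => _) in free.
set phi := ncps_exp A in xmu ynu xyrho.
set f := eta_series mu; set g := eta_series nu.
have f0 : f [::] = 0 := eta_nil mu; have g0 : g [::] = 0 := eta_nil nu.
have [As [Bs AB]] := boxed_sol_ex f g; have [AE BE] := AB.
set h := \sum_j Bs j * ncz C j * As j.
have fG : ncsubst f _ = h := boxed_substl f0 AB.
have gH : ncsubst g _ = h := boxed_substr g0 AB.
pose G j := ncz C j * As j; pose H j := Bs j * ncz C j.
rewrite -/G -/H in fG gH AE BE.
have G0 j : G j [::] = 0 by apply: zM_nil.
have H0 j : H j [::] = 0 by apply: Mz_nil.
have h0 : h [::] = 0 by rewrite -fG subst_nil.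
have hU := unit1B h0.
pose r := (1 - h)^-1.
suff rhoE : 1 + moment_series rho = r.
  exists As, Bs; split=> //; rewrite -/h.
  have : 1 - eta_series rho = 1 - h by apply: invr_inj; rewrite invr1Beta rhoE.
  by move=> /addrI/oppr_inj.
pose io := @sas C A k; pose K := @asC A 'I_k.
have ioK t a : io t * K a = K a * io t := sasC t a.
have sum0 (F : 'I_k -> ncseries C k) (a : 'I_k -> A) :
    (forall j, F j [::] = 0) -> (\sum_j io (F j) * K (a j)) [::] = 0.
  move=> F0; rewrite as_sum big1 // => j _.
  by rewrite asM_nil /= F0 scale0r mul0r.
have [U [U1 U2]] := asinv_ex (sum0 G x G0).
have [V [V1 V2]] := asinv_ex (sum0 H y H0).
have z0 (j : 'I_k) : ncz C j [::] = 0 by [].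
have [W [W1 W2]] := asinv_ex (sum0 (@ncz C k) (fun j => x j * y j) z0).
have expW : expect phi W = 1 + moment_series rho.
  have := expect_resolvent phi 1 1 z0 W1.
  rewrite asC1 mul1r mulr1 => ->; rewrite subst_id; apply: ncseriesP => w.
  by rewrite moment1E /= mul1r mulr1 xyrho.
(* [U x_j] collects the moments of [mu] with last letter [x_j], that is [dr j] of
   [(1 - f)^-1 = 1 + (1 - f)^-1 f], evaluated at [G]. *)
have expU j : expect phi (U * K (x j)) = r * Bs j.
  have := expect_resolvent phi 1 (x j) G0 U1; rewrite asC1 mul1r => ->.
  have -> : NCSeries (fun w => phi (1 * \prod_(i <- w) x i * x j)) =
      dr j (1 - f)^-1.
    apply: ncseriesP => w; rewrite /f invr1Beta [RHS]moment1E xmu.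
    by rewrite big_rcons /= mul1r.
  have -> : dr j (1 - f)^-1 = (1 - f)^-1 * dr j f.
    have {1}-> : (1 - f)^-1 = 1 + (1 - f)^-1 * f.
      apply: (mulrI (unit1B f0)).
      by rewrite mulrDr mulrV ?unit1B // mulr1 mulrA mulrV ?unit1B // mul1r subrK.
    have -> : dr j (1 + (1 - f)^-1 * f) = dr j ((1 - f)^-1 * f).
      by apply: ncseriesP => w; rewrite /= -size_eq0 size_rcons add0r.
    by rewrite drM f0 scale0r addr0.
  by rewrite substM // substV ?unit1B // substB subst1 // fG -BE.
have expV j : expect phi (K (y j) * V) = As j * r.
  have := expect_resolvent phi (y j) 1 H0 V1; rewrite asC1 mulr1 => ->.
  have -> : NCSeries (fun w => phi (y j * \prod_(i <- w) y i * 1)) =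
      dl j (1 - g)^-1.
    apply: ncseriesP => w; rewrite /g invr1Beta [RHS]moment1E ynu.
    by rewrite big_cons /= mulr1.
  have -> : dl j (1 - g)^-1 = dl j g * (1 - g)^-1.
    have {1}-> : (1 - g)^-1 = 1 + g * (1 - g)^-1.
      apply: (mulIr (unit1B g0)).
      by rewrite mulrDl mulVr ?unit1B // mul1r mulrVK ?unit1B // subrK.
    by rewrite dlD dl1 add0r dlM g0 scale0r add0r.
  by rewrite substM // substV ?unit1B // substB subst1 // gH -AE.

have ioM (t t' : ncseries C k) : io (t * t') = io t * io t' by apply: rmorphM.
have KM p q : K (p * q) = K p * K q by rewrite /K asCC.
have io1h : io (1 - h) = 1 - io h by rewrite /io rmorphB rmorph1.
have ior : io r * io (1 - h) = 1 by rewrite -ioM mulVr // /io rmorph1.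
have iorV : io (1 - h) * io r = 1 by rewrite -ioM mulrV // /io rmorph1.
pose u := io (1 - h) * U; pose v := V * io (1 - h).
pose a j := u * K (x j) - io (Bs j); pose b j := K (y j) * v - io (As j).
(* Writing [u x_j = a_j + B_j] in [u = (1 - h) + sum_j u x_j G_j], the terms [B_j G_j] add up to [h]
   and cancel it. *)
have uE : u = 1 + \sum_j a j * io (G j).
  have {1}-> : u = io (1 - h) + \sum_j u * K (x j) * io (G j).
    rewrite {1}/u; have {1}-> : U = 1 + U * \sum_j io (G j) * K (x j).
      by apply/eqP; rewrite -subr_eq -{1}[U]mulr1 -mulrBr U2.
    rewrite mulrDr mulr1 mulrA mulr_sumr; congr (_ + _).
    by apply: eq_bigr => j _; rewrite ioK mulrA.
  under [in RHS]eq_bigr do rewrite mulrBl.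
  rewrite sumrB io1h -addrA; congr (_ + _); rewrite addrC; congr (_ - _).
  rewrite /h /io rmorph_sum; apply: eq_bigr => j _.
  by rewrite -mulrA rmorphM.
have vE : v = 1 + \sum_j io (H j) * b j.
  have {1}-> : v = io (1 - h) + \sum_j io (H j) * (K (y j) * v).
    rewrite {1}/v; have {1}-> : V = 1 + (\sum_j io (H j) * K (y j)) * V.
      by apply/eqP; rewrite -subr_eq -{1}[V]mul1r -mulrBl V1.
    rewrite mulrDl mul1r -mulrA mulr_suml; congr (_ + _).
    by apply: eq_bigr => j _; rewrite [RHS]mulrA.
  under [in RHS]eq_bigr do rewrite mulrBr.
  rewrite sumrB io1h -addrA; congr (_ + _); rewrite addrC; congr (_ - _).
  by rewrite /h /io rmorph_sum; apply: eq_bigr => j _; rewrite rmorphM.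
(* Chosen so that [v E = W]. *)
pose E := io r * (1 - \sum_j io (H j) * K (y j)) * W.
have vEW : v * E = W.
  by rewrite /v /E !mulrA -(mulrA V) iorV mulr1 V2 mul1r.
pose s j := io (ncz C j) * (b j * E) - io (G j) * \sum_i io (H i) * (b i * E).
(* Expand [u (1 - sum_j z_j x_j y_j) v E = u] with [u x_j = a_j + B_j] and [y_j v = b_j + A_j]: [P2]
   and [P3] cancel, leaving [(1 - h) E + P4 - P1 = u]. *)
have EE : io (1 - h) * E = u + \sum_j a j * s j.
  have : u * (1 - \sum_j io (ncz C j) * K (x j * y j)) * (v * E) = u.
    by rewrite vEW -mulrA W1 mulr1.
  pose P1 := \sum_j a j * io (ncz C j) * (b j * E).
  pose P2 := \sum_j a j * io (G j) * E.
  pose P3 := \sum_j io (H j) * (b j * E).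
  pose P4 := \sum_j a j * io (G j) * P3.
  have uvE : u * (v * E) = E + P3 + (P2 + P4).
    have vE' : v * E = E + P3.
      rewrite vE mulrDl mul1r mulr_suml; congr (_ + _).
      by apply: eq_bigr => j _; rewrite mulrA.
    by rewrite uE vE' mulrDl mul1r mulrDr !mulr_suml.
  have uTvE : u * (\sum_j io (ncz C j) * K (x j * y j)) * (v * E) =
      P1 + P2 + (P3 + io h * E).
    rewrite /P3 {1}/h [io _]rmorph_sum mulr_suml -!big_split mulr_sumr mulr_suml.
    apply: eq_bigr => j _; rewrite KM.
    have -> : u * (io (ncz C j) * (K (x j) * K (y j))) * (v * E) =
        (a j + io (Bs j)) * io (ncz C j) * ((b j + io (As j)) * E).
      by rewrite /a /b !subrK (mulrA (io _)) ioK !mulrA.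
    move: (a j) (b j) => aj bj.
    rewrite /= -/(io (Bs j * ncz C j * As j)) /G /H !ioM !mulrDl !mulrDr -!mulrA.
    by [].
  rewrite mulrBr mulr1 mulrBl uvE uTvE => EQ; rewrite -[in RHS]EQ io1h mulrBl mul1r.
  have -> : \sum_j a j * s j = P1 - P4.
    by rewrite -sumrB; apply: eq_bigr => j _; rewrite mulrBr !mulrA.
  move: P1 P2 P3 P4 {uvE uTvE EQ} => P1 P2 P3 P4.
  rewrite addrAC -(addrA (E + P3)) (addrACA P2) subrr addr0 (addrC P2).
  by rewrite -(addrA E) (addrC P3) [P1 + P2 + (P3 + _)]addrA addrKA.
have memU := resolvent_mem G0 (S := S true) (fun j => ex_intro2 _ _ j I erefl) U1.
have memV := resolvent_mem H0 (S := S false) (fun j => ex_intro2 _ _ j I erefl) V1.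
have sas_mem c t w : gen_subalg (S c) (io t w).
  by apply: gen_subalgZ; apply: gen_subalg1.
have mulmem c (t t' : aseries A 'I_k) : (forall w, gen_subalg (S c) (t w)) ->
    (forall w, gen_subalg (S c) (t' w)) -> forall w, gen_subalg (S c) ((t * t') w).
  move=> tS t'S w; apply: gen_subalg_sum => i.
  exact: gen_subalgM.
have memB c d d' : gen_subalg (S c) d -> gen_subalg (S c) d' ->
    gen_subalg (S c) (d - d').
  by move=> dS d'S; rewrite -scaleN1r addrC; apply: gen_subalgP.
have ac j : centered S true (a j).
  move=> w; split.
    rewrite asD asN asMC; apply: memB => //; apply: gen_subalgM.
      exact: mulmem.
    by apply: mem_gen_subalg; exists j.
  have -> : phi (a j w) = expect phi (a j) w by [].
  rewrite expectB /u -mulrA expect_sasM expU mulVKr //.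
  by rewrite -[io _]mul1r expect_Msas -asC1 expectC ncps_exp1 scale1r mul1r subrr.
have bc j : centered S false (b j).
  move=> w; split.
    rewrite asD asN asCM; apply: memB => //; apply: gen_subalgM.
      by apply: mem_gen_subalg; exists j.
    exact: mulmem.
  have -> : phi (b j w) = expect phi (b j) w by [].
  rewrite expectB /v mulrA expect_Msas expV mulrVK //.
  by rewrite -[io _]mul1r expect_Msas -asC1 expectC ncps_exp1 scale1r mul1r subrr.
have Er : E = io r * u + io r * \sum_j a j * s j.
  by rewrite -mulrDr -EE mulrA ior mul1r.
(* In [E = r (u + sum_j a_j s_j)] every [b_i E] inside [s_j] comes after [z_j] or [G_j], which have
   no constant term, so the claim passes from [n] to [n + 1]. *)
have Ef n : follows S false n E.
  elim: n => [|n IHn]; first by move=> l la w.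
  rewrite Er; apply: followsD; apply: follows_sasM.
    rewrite uE; apply: followsD; first exact: follows1.
    apply: follows_sum => j; apply: follows_Msas.
    exact: follows_centered.
  apply: follows_sum => j; apply: follows_centeredM => //.
  have bE i : follows S true n (b i * E) by apply: follows_centeredM.
  apply: followsD; first exact: follows_sasM0.
  apply: followsN; apply: follows_sasM0 => //.
  by apply: follows_sum => i; apply: follows_sasM.
have bE j n : follows S true n (b j * E) by apply: follows_centeredM.
have expu : expect phi u = 1.
  rewrite uE expectD expect_sum big1 => [|j _]; last first.
    by rewrite expect_Msas (expect_centered (ac j)) mul0r.
  by rewrite -asC1 expectC ncps_exp1 scale1r addr0.
have expE : expect phi E = r.
  rewrite Er expectD (expect_sasM _ r u) expu.
  rewrite (expect_sasM _ r (\sum_j _)) [X in _ + r * X]expect_sum.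
  rewrite [X in _ + r * X]big1 => [|j _]; last first.
    apply: (expect_centeredM (ac j)) => n.
    apply: followsD; first exact: follows_sasM.
    apply: followsN; apply: follows_sasM => //.
    by apply: follows_sum => i; apply: follows_sasM.
  by rewrite mulr0 addr0 mulr1.
(* Here [W = v E = E + sum_j H_j b_j E], and freeness removes every term but [E]. *)
rewrite -expW -vEW vE mulrDl mul1r expectD expE mulr_suml expect_sum.
rewrite big1 ?addr0 // => j _.
rewrite -mulrA expect_sasM (expect_centeredM (bc j)) ?mulr0 // => n.
Qed.
End FreeMulConvBoxed.

(** * The maps B_t *)

Lemma free_mul_convP (C : fieldType) (k : nat) (mu nu : dist C k) :
  is_free_mul_conv mu nu (free_mul_conv mu nu).
Proof.
have [rho rhoP] := is_free_mul_conv_ex mu nu.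
by rewrite /free_mul_conv; case: xgetP => [_ -> //|/(_ rho)].
Qed.

(** Flowing [eta_series mu] for time 1 gives the eta-series of a distribution with R-transform
    [eta_series mu], so [xget] finds one. *)
Lemma boolBP_R (C : fieldType) (k : nat) (mu : dist C k) :
  R_transform (boolBP mu) = eta_series mu.
Proof.
have [h etah] := bflow_ex 1 (eta_nil mu); have [_ h0 _] := etah.
have [nu nuE] := eta_ex h0; rewrite -nuE in etah.
rewrite /boolBP; case: xgetP => [_ -> //|/(_ nu)[]].
exact/R_transformE.
Qed.

Section BtProperties.
Local Open Scope complex_scope.
Variables (R : realType) (k : nat).
Implicit Types (mu nu : dist R[i] k) (t : R).

Lemma R_free_add_pow t mu :
  R_transform (free_add_pow t mu) = t%:C *: R_transform mu.
Proof.
have [r0 _ _] := bflow_R mu.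
have tr0 : (t%:C *: R_transform mu) [::] = 0 by rewrite ncsZ r0 mulr0.
have [h trh] := bflow_ex 1 tr0; have [_ h0 _] := trh.
have [nu nuE] := eta_ex h0; rewrite -nuE in trh.
rewrite /free_add_pow; case: xgetP => [_ -> //|/(_ nu)[]].
exact/R_transformE.
Qed.

Lemma eta_bool_add_pow t mu :
  eta_series (bool_add_pow t mu) = t%:C *: eta_series mu.
Proof.
have th0 : (t%:C *: eta_series mu) [::] = 0 by rewrite ncsZ eta_nil mulr0.
have [nu nuE] := eta_ex th0.
by rewrite /bool_add_pow; case: xgetP => [_ -> //|/(_ nu)[]].
Qed.

(** The free power has R-transform [(1 + t) R_mu] and eta-series [(1 + t) h], with [h] that of
    [Bt t mu]; dividing by [1 + t] gives a flow of time [1 + t] from [R_mu] to [h]. Going first from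
    [eta_mu] back to [R_mu], in time -1, leaves time [t]. *)
Lemma bflow_Bt t mu : 0 <= t ->
  bflow t%:C (eta_series mu) (eta_series (Bt t mu)).
Proof.
move=> t0; have t1 : 1 + t != 0 by rewrite gt_eqF // ltr_wpDr.
have c1 : (1 + t)%:C != 0 :> R[i] by rewrite eq_complex /= negb_and t1.
set h := eta_series (Bt t mu).
have hE : eta_series (free_add_pow (1 + t) mu) = (1 + t)%:C *: h.
  by rewrite /h eta_bool_add_pow scalerA -rmorphM /= mulrCA mul1r mulfV // scale1r.
have := bflow_R (free_add_pow (1 + t) mu); rewrite R_free_add_pow hE.
case=> _ _; rewrite scale1r substZ -ncsscaleAl => /(scalerI c1) rh.
have [r0 _ _] := bflow_R mu.
have {}rh : bflow (1 + t)%:C (R_transform mu) h by split=> //; apply: eta_nil.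
have -> : t%:C = - 1 + (1 + t)%:C by rewrite rmorphD rmorph1 addKr.
exact: bflow_trans (bflow_sym (bflow_R mu)) rh.
Qed.

End BtProperties.

Theorem theorem4p11 (R : realType) (k : nat) (hk : (1 <= k)%N) :
  (forall t : R, 0 <= t -> bijective (@Bt R k t)) /\
  (forall s t : R, 0 <= s -> 0 <= t -> @Bt R k s \o @Bt R k t = @Bt R k (s + t)) /\
  @Bt R k 1 = @boolBP R[i] k /\
  (forall t : R, 0 <= t -> forall mu nu : dist R[i] k,
     Bt t (free_mul_conv mu nu) = free_mul_conv (Bt t mu) (Bt t nu)).
Proof.
split; [|split; [|split]].
- move=> t t0.
  (* The inverse map flows the eta-series for time [- t]. *)
  pose P (nu mu : dist R[i] k) :=
    bflow (- t%:C)%C (eta_series nu) (eta_series mu).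
  have exP nu : exists mu, P nu mu.
    have [f nuf] := bflow_ex (- t%:C)%C (eta_nil nu); have [_ f0 _] := nuf.
    by have [mu muE] := eta_ex f0; exists mu; rewrite /P muE.
  have [B BP] := choice exP; exists B => mu; apply: eta_inj.
    exact: bflow_fun (BP _) (bflow_sym (bflow_Bt mu t0)).
  have := bflow_sym (BP mu); rewrite opprK.
  exact: bflow_fun (bflow_Bt _ t0).
- move=> s t s0 t0; apply: funext => mu; apply: eta_inj.
  have := bflow_trans (bflow_Bt mu t0) (bflow_Bt (Bt t mu) s0).
  rewrite addrC -rmorphD => st; apply: bflow_fun st _.
  by apply: bflow_Bt; apply: addr_ge0.
- apply: funext => mu; apply: eta_inj.
  have /R_transformE := boolBP_R mu; apply: bflow_fun.
  by rewrite -[1](rmorph1 (real_complex R)); apply: bflow_Bt.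
move=> t t0 mu nu; apply: eta_inj.
(* Both sides have the boxed convolution of the transformed eta-series as eta-series, and that is
   single-valued. *)
have Btconv := boxed_bflow (bflow_Bt mu t0) (bflow_Bt nu t0)
  (bflow_Bt (free_mul_conv mu nu) t0)
  (free_mul_conv_boxed (free_mul_convP mu nu)).
apply: boxed_fun Btconv _.
exact: free_mul_conv_boxed (free_mul_convP _ _).
Qed.
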